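(* Let $q$ be a prime power and let $\theta$ be a generator of $\mathbb{F}_q^*$. Let $k\ge 1$, let $d_1,\ldots,d_k>1$ be divisors of $q-1$, put $\mathbf{d}=(d_1,\ldots,d_k)$, and let $\mathbf{a}=(\mathbf{a}_1,\ldots,\mathbf{a}_k)\in\Lambda(\mathbf{d})$. Suppose that the $k$-tuple $\mathbf{P}=(P_1,\ldots,P_k)$ of nonzero polynomials in $\mathbb{F}_q[x]$ is $\mathbf{d}$-multiplicatively independent over $\mathbb{F}_q$, and let $Z(\mathbf{P})$ be the number of distinct roots of $P_1\cdots P_k$ in an algebraic closure of $\mathbb{F}_q$. Let $N(\mathbf{P},\mathbf{a}(\mathbf{d}),q)$ be the number of elements $y\in\mathbb{F}_q$ such that $P_i(y)\neq 0$ for every $1\le i\le k$ and $\log_{\theta}P_i(y)\equiv \mathbf{a}_i\pmod{d_i}$ for every $1\le i\le k$. Then $$N(\mathbf{P},\mathbf{a}(\mathbf{d}),q)=\frac{q}{d_1\cdots d_k}+H(\mathbf{P},\mathbf{d}),$$ where $|H(\mathbf{P},\mathbf{d})|<Z(\mathbf{P})\cdot\sqrt{q}$. In particular, $N(\mathbf{P},\mathbf{a}(\mathbf{d}),q)>0$ if $Z(\mathbf{P})\le \frac{\sqrt{q}}{d_1\cdots d_k}$.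
   Context: For a generator $\theta$ of the cyclic group $\mathbb{F}_q^*$ and $a\in\mathbb{F}_q^*$, $\log_\theta a$ is the unique integer $i\in\{1,\ldots,q-1\}$ with $a=\theta^i$. For $\mathbf{d}=(d_1,\ldots,d_k)$ with each $d_i>1$ a divisor of $q-1$, $\Lambda(\mathbf{d})=\prod_{i=1}^k\{0,1,\ldots,d_i-1\}$; the $i$-th coordinate of $\mathbf{a}\in\Lambda(\mathbf{d})$ is denoted $\mathbf{a}_i$. A $k$-tuple $\mathbf{P}=(P_1,\ldots,P_k)$ of nonzero polynomials in $\mathbb{F}_q[x]$ is $\mathbf{d}$-multiplicatively independent over $\mathbb{F}_q$ if, with $L=\mathrm{lcm}(d_1,\ldots,d_k)$, for every $\mathbf{a}\in\Lambda(\mathbf{d})$ an equality $$P_1^{\frac{L}{d_1}\mathbf{a}_1}\cdots P_k^{\frac{L}{d_k}\mathbf{a}_k}=u\,G(x)^L$$ with $u\in\mathbb{F}_q^*$ and $G\in\mathbb{F}_q[x]$ monic implies $\mathbf{a}=(0,\ldots,0)$ and $G(x)=u=1$. *)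

(* Defs.v *)
From mathcomp Require Import all_boot all_order all_algebra.
From mathcomp Require Import all_fingroup all_solvable all_field.
Set Implicit Arguments.
Unset Strict Implicit.
Unset Printing Implicit Defensive.
Import GRing.Theory.
Local Open Scope ring_scope.

(* The unique i in {1, ..., #|F| - 1} with a = theta ^+ i, when there is one
   (see dlogP); the value 0 otherwise, in particular at a = 0. *)
Definition dlog (F : finFieldType) (theta : {unit F}) (a : F) : nat :=
  if [pick i : 'I_#|F| | (0 < i)%N && (a == val theta ^+ i)] is Some i
  then i else 0%N.

Definition in_Lambda (k : nat) (d a : 'I_k -> nat) : Prop :=
  forall i, (a i < d i)%N.

Definition mult_indep (F : fieldType) (k : nat) (d : 'I_k -> nat)
    (P : 'I_k -> {poly F}) : Prop :=
  let L := \big[lcmn/1%N]_(i < k) d i in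
  forall a : 'I_k -> nat, in_Lambda d a ->
  forall (u : F) (G : {poly F}), u != 0 -> G \is monic ->
    \prod_(i < k) P i ^+ (L %/ d i * a i) = u *: G ^+ L ->
    [/\ forall i, a i = 0%N, G = 1 & u = 1].

Definition is_alg_closure (F : fieldType) (K : closedFieldType)
    (iota : {rmorphism F -> K}) : Prop :=
  forall z : K, algebraicOver iota z.

(* Meaningful for p != 0 only (see mem_distinct_roots). *)
Definition distinct_roots (K : closedFieldType) (p : {poly K}) : seq K :=
  undup (sval (closed_field_poly_normal p)).

Definition Zcount (F : fieldType) (K : closedFieldType)
    (iota : {rmorphism F -> K}) (k : nat) (P : 'I_k -> {poly F}) : nat :=
  size (distinct_roots (map_poly iota (\prod_(i < k) P i))).

Definition Ncount (F : finFieldType) (theta : {unit F}) (k : nat)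
    (d a : 'I_k -> nat) (P : 'I_k -> {poly F}) : nat :=
  #|[set y : F | [forall i, ((P i).[y] != 0)
                  && (dlog theta (P i).[y] == a i %[mod d i])]]|.

Lemma mem_distinct_roots (K : closedFieldType) (p : {poly K}) (x : K) :
  p != 0 -> (x \in distinct_roots p) = root p x.
Proof.
rewrite /distinct_roots mem_undup; case: closed_field_poly_normal => r /= Dp.
rewrite -lead_coef_eq0 => p0.
by rewrite Dp rootZ // root_prod_XsubC.
Qed.

Lemma dlogP (F : finFieldType) (theta : {unit F}) (a : F) :
  generator [set: {unit F}] theta -> a != 0 ->
  [/\ (0 < dlog theta a < #|F|)%N, val theta ^+ dlog theta a = a
    & forall i, (0 < i < #|F|)%N -> val theta ^+ i = a -> i = dlog theta a].
Proof.
move=> /eqP gen a0.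
have ord : #[theta]%g = #|F|.-1 by rewrite orderE -gen card_finField_unit.
have F1 : (1 < #|F|)%N by apply: finNzRing_gt1.
have ex : exists2 i : 'I_#|F|, (0 < i)%N & a = val theta ^+ i.
  have ua : a \is a GRing.unit by rewrite unitfE.
  have : FinRing.Unit ua \in <[theta]>%g by rewrite -gen inE.
  case/cyclePmin=> j; rewrite ord => jlt Ej.
  have {}Ej : a = val theta ^+ j by rewrite -FinRing.val_unitX -Ej.
  case: j => [|j] in jlt Ej *.
    have ltF : (#|F|.-1 < #|F|)%N by rewrite prednK // ltnW.
    exists (Ordinal ltF) => //=.
    by rewrite -ord -FinRing.val_unitX expg_order Ej expr0.
  have ltF : (j.+1 < #|F|)%N by apply: leq_trans jlt (leq_pred _).
  by exists (Ordinal ltF).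
have uniq_log (i j : nat) : (0 < i < #|F|)%N -> (0 < j < #|F|)%N ->
    val theta ^+ i = val theta ^+ j -> i = j.
  case: i j => [|i] // [|j] // /= hi hj.
  rewrite -!FinRing.val_unitX => E.
  have {}E : (theta ^+ i.+1 = theta ^+ j.+1)%g by exact: val_inj E.
  have M : i.+1 == j.+1 %[mod #[theta]%g].
    by rewrite -eq_expg_mod_order; exact: (introT eqP E).
  rewrite -[i.+1]addn1 -[j.+1]addn1 eqn_modDr in M.
  move: M; rewrite ord !modn_small ?ltn_predRL //.
  by move=> /eqP ->.
rewrite /dlog; case: pickP => [i /andP[i0 /eqP Ea]|none]; last first.
  by case: ex => i i0 Ea; move: (none i); rewrite i0 -Ea eqxx.
split=> [||j hj Ej]; rewrite ?i0 ?ltn_ord //.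
by apply: uniq_log; rewrite ?i0 ?ltn_ord // Ej.
Qed.

(* Main.v *)
Require Import Defs.
From HB Require Import structures.
From mathcomp Require Import all_boot all_order all_algebra.
From mathcomp Require Import all_fingroup all_solvable all_field.
From mathcomp Require Import zify ring.
Set Implicit Arguments.
Unset Strict Implicit.
Unset Printing Implicit Defensive.
Import Order.TTheory GRing.Theory Num.Theory.
Local Open Scope ring_scope.

(** Let [q] be the cardinal of [F], [L] the lcm of the [d i] and [D] their
    product.  Let [chi] be a character of order [L] of the multiplicative group
    of [F].  By orthogonality of roots of unity, [D * N] is a sum, over the tuples
    [j] with [j i < d i], of complex numbers of modulus [1] times the sums of
    [chi] over the values of [f_j = \prod_i P i ^+ (L / d i * j i)] at the points
    where no [P i] vanishes.  The zero tuple contributes [q], up to at most [Z].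
    Multiplicative independence says that no other [f_j] is a constant times an
    [L]-th power, so each of the [D - 1] remaining sums is at most
    [(Z - 1) sqrt q] by the Weil bound ([weil_bound]), and
    [Z + (D - 1) (Z - 1) sqrt q < D Z sqrt q].

    To prove the Weil bound for [f], let [S_n] be the corresponding sum over the
    field with [q ^ n] elements, where [chi] is composed with the norm.

    The [S_n] are power sums ([L_power_sums]).  Through resultants, [chi] and [f]
    define a completely multiplicative function [lam] of polynomials over [F],
    periodic modulo the product [h], of degree [Z], of the ['X - rho] over the
    roots [rho] of the [P i].  Counting the points whose norm divides a given
    monic polynomial yields Newton's identities between the [S_n], multiplied by
    the [n]-th power of a constant of modulus [1], and the sums [c_d] of [lam]
    over monic polynomials of degree [d].  As [lam] is not trivial,
    [c_d = 0] for [d >= Z]; hence [S_n = - (w_1 ^ n + ... + w_s ^ n)] for complex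
    numbers [w_i], with [s <= Z - 1].

    They have square-root size for even [n] ([charsum_even_bound]):
    [S_(2 n) = O(q ^ n)].  This comes from the method of Stepanov ([stepanov]),
    with the device of Bombieri of using perfect [r]-th powers, [r = q ^ n],
    in place of derivatives to produce zeros of high multiplicity.  It bounds from
    above the number of points where the norm of [f] has a given residue class,
    and the lower bound follows as the classes exhaust the field.  The same
    estimate shows that [lam] is not trivial.

    Comparing the two for large [n] forces [|w_i| <= sqrt q], and the case
    [n = 1] is the Weil bound.  All extensions are realized inside [K] as fixed
    points of powers of the Frobenius map, and objects over [F] are recognized
    as those fixed by Frobenius. *)

(** * Radicals of polynomials and resultants *)

Lemma size_det_leq (R : idomainType) n (M : 'M[{poly R}]_n) (s : 'I_n -> nat) :
  (forall i j, (size (M i j) <= (s i).+1)%N) ->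
  (size (\det M) <= (\sum_i s i).+1)%N.
Proof.
move=> sM; rewrite /determinant.
apply: leq_trans (size_sum _ _ _) _; apply/bigmax_leqP => p _.
rewrite -signr_odd mulr_sign; set Q := \prod_(i < n) _.
suff sQ : (size Q <= (\sum_i s i).+1)%N by case: ifP; rewrite ?size_polyN.
apply: leq_trans (size_poly_prod_leq _ _) _.
rewrite leq_subLR card_ord addnS ltnS.
rewrite -[n in (n + _)%N]card_ord -sum1_card -big_split /=.
by apply: leq_sum => i _; rewrite add1n.
Qed.

(** The companion matrix [C] of [g] satisfies [C ^+ L = c%:M], because [g]
    divides ['X^L - c]; [u] is its determinant, the norm of an [L]-th root of
    [c] from the extension defined by [g]. *)
Lemma binomial_factor_norm (E : fieldType) (g : {poly E}) (c : E) (L : nat) :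
  (1 < size g)%N -> g %| 'X^L - c%:P ->
  exists u, u ^+ L = c ^+ (size g).-1.
Proof.
move=> sg dvg.
wlog mg : g sg dvg / g \is monic.
  move=> W; have g0 : lead_coef g != 0.
    by rewrite lead_coef_eq0 -size_poly_gt0 ltnW.
  have sz : size ((lead_coef g)^-1 *: g) = size g by rewrite size_scale // invr_eq0.
  rewrite -sz; apply: W; first by rewrite sz.
    by rewrite dvdpZl // invr_eq0.
  by rewrite monicE lead_coefZ mulVf.
have := companionmxK mg; move: (companionmx g).
case E1: (size g).-1 => [|n]; first by move: sg E1; case: (size g) => [|[]].
move=> C HC; exists (\det C).
have : horner_mx C ('X^L - c%:P) = 0.
  by have /dvdpP[w ->] := dvg; rewrite rmorphM /= -HC Cayley_Hamilton mulr0.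
rewrite rmorphB rmorphXn /= horner_mx_X horner_mx_C => /subr0_eq E2.
have <- : \det (c%:M : 'M_n.+1) = c ^+ n.+1 by rewrite det_scalar.
rewrite -E2; elim: (L) => [|l IH]; first by rewrite !expr0 det1.
by rewrite !exprS det_mulmx IH.
Qed.

Lemma fraction_repr (R : idomainType) (u : {fraction R}) :
  exists a b : R, b != 0 /\ u * (FracField.tofrac b) = FracField.tofrac a.
Proof.
elim/quotW: u => x; exists \n_x, \d_x; split; first exact: denom_ratioP.
unlock FracField.tofrac; rewrite -[LHS]FracField.pi_mul; apply/eqmodP.
rewrite /= FracField.equivfE /FracField.mulf /=.
by rewrite !numden_Ratio ?(oner_neq0, mul1r, mulr1) ?mulf_neq0 ?denom_ratioP // mulrC.
Qed.

(** The class of [f] modulo constants and [L]-th powers, over an algebraically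
    closed [K], has order exactly [L]: by Kummer theory this is what makes an
    [L]-th root of [f] an algebraic function of degree [L]. *)
Definition exact_power_order (K : fieldType) (f : {poly K}) (L : nat) :=
  forall e, (0 < e < L)%N -> exists rho, ~~ (L %| e * mup rho f)%N.

Lemma mupX (K : fieldType) (f : {poly K}) x n :
  f != 0 -> mup x (f ^+ n) = (n * mup x f)%N.
Proof.
move=> f0; elim: n => [|n IH]; first by rewrite expr0 mupNroot // root1.
by rewrite exprS mupM ?expf_neq0 // IH mulSn.
Qed.

(** [T ^ L - c / f] is irreducible over the rational functions.  A common
    factor with [A] would have degree [e] with [0 < e < L], and comparing
    norms gives [a ^+ L * f ^+ e = c ^+ e * b ^+ L] for some polynomials [a]
    and [b]; the multiplicity of any root then makes [L] divide
    [e * mup rho f], against the hypothesis. *)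
Lemma resultant_radical_neq0 (K : fieldType) (f : {poly K}) (c : K) (L : nat)
    (A : {poly {poly K}}) :
  f != 0 -> c != 0 -> exact_power_order f L -> A != 0 -> (size A <= L)%N ->
  resultant (f%:P * 'X^L - c%:P%:P) A != 0.
Proof.
move=> f0 c0 kf A0 sA.
pose tf : {rmorphism {poly K} -> {fraction {poly K}}} := @FracField.tofrac {poly K}.
have L0 : (0 < L)%N by apply: leq_trans sA; rewrite size_poly_gt0.
set B := f%:P * 'X^L - c%:P%:P.
have sB : size B = L.+1.
  rewrite size_polyDl ?size_polyN size_Cmul ?size_polyXn // size_polyC polyC_eq0.
  by rewrite c0 ltnS.
have B0 : B != 0 by rewrite -size_poly_gt0 sB.
rewrite -tofrac_eq0 -[FracField.tofrac _]/(tf _).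
rewrite map_resultant ?tofrac_eq0 ?lead_coef_eq0 //.
rewrite resultant_eq0 -leqNgt leqNgt; apply/negP; set g := gcdp _ _ => sg.
have g_B : g %| map_poly tf B by exact: dvdp_gcdl.
have g_A : g %| map_poly tf A by exact: dvdp_gcdr.
have tff0 : tf f != 0 by rewrite tofrac_eq0.
have EB : map_poly tf B = tf f *: ('X^L - (tf c%:P / tf f)%:P).
  rewrite rmorphB rmorphM /= !map_polyC /= map_polyXn scalerBr mul_polyC.
  by congr (_ - _); rewrite -mul_polyC -polyCM mulrC divfK.
rewrite EB dvdpZr // in g_B.
have [u Hu] := binomial_factor_norm sg g_B.
have sgL : ((size g).-1 < L)%N.
  have sgA : (size g <= size A)%N.
    rewrite -[size A](size_map_inj_poly (f := tf)) ?tofrac0 //; last first.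
      by move=> x y /eqP; rewrite tofrac_eq => /eqP.
    apply: dvdp_leq g_A; rewrite map_poly_eq0_id0 ?tofrac_eq0 ?lead_coef_eq0 //.
  by apply: leq_trans (leq_trans sgA sA); rewrite prednK // (ltn_trans _ sg).
set e := (size g).-1 in Hu sgL.
have e0 : (0 < e)%N by rewrite /e -subn1 subn_gt0.
have [rho] := kf e (introT andP (conj e0 sgL)).
have [a [b [b0 Eab]]] := fraction_repr u.
have E2 : a ^+ L * f ^+ e = c%:P ^+ e * b ^+ L.
  apply/eqP; rewrite -tofrac_eq; apply/eqP.
  rewrite !tofracM !tofracXn -Eab exprMn Hu expr_div_n -/tf.
  rewrite -mulrA [_ * tf f ^+ e]mulrC mulrA divfK ?expf_neq0 //.
have a0 : a != 0.
  apply/eqP => a0; move: E2; rewrite a0 expr0n gtn_eqF // mul0r => /esym/eqP.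
  by rewrite mulf_eq0 !expf_eq0 polyC_eq0 (negPf c0) (negPf b0) !andbF.
move/(congr1 (mup rho)): E2.
rewrite !mupM ?expf_neq0 ?polyC_eq0 // !mupX ?polyC_eq0 //.
rewrite [mup rho c%:P]mupNroot ?rootC // muln0 add0n => E3.
by rewrite -(dvdn_addr _ (dvdn_mulr (mup rho a) (dvdnn L))) E3 dvdn_mulr.
Qed.

Lemma size_resultant_leq (R : idomainType) (p q : {poly {poly R}}) (m e : nat) :
  (forall j, (size (p`_j)%R <= m.+1)%N) -> (forall j, (size (q`_j)%R <= e.+1)%N) ->
  (size (resultant p q) <= ((size q).-1 * m + (size p).-1 * e).+1)%N.
Proof.
move=> sp sq.
pose s (k : 'I_((size q).-1 + (size p).-1)) :=
  match split k with inl _ => m | inr _ => e end.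
have -> : ((size q).-1 * m + (size p).-1 * e = \sum_k s k)%N.
  rewrite big_split_ord /= -[X in (X * m)%N]card_ord -[X in (X * e)%N]card_ord.
  rewrite -!sum_nat_const; congr (_ + _)%N; apply: eq_bigr => i _; rewrite /s.
    by case: split_ordP => // k /eqP; rewrite eq_lrshift.
  by case: split_ordP => // k /eqP; rewrite eq_rlshift.
apply: size_det_leq => i j; rewrite Sylvester_mxE /s.
by case: (split i) => k; rewrite mulrb; case: ifP; rewrite ?size_poly0.
Qed.

(** Modulo [('X - tau) ^ r], [G] behaves as an [L]-th root of [c / f].  The
    resultant of [f T ^ L - c] and [\sum_i A i T ^ i] lies in the ideal they
    generate, so evaluating at [T = G] shows that it is divisible by
    [('X - tau) ^ r]; its degree is less than [r], hence it vanishes, which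
    contradicts [resultant_radical_neq0] unless all the [A i] are zero. *)
Lemma radical_indep (K : fieldType) (f G : {poly K}) (c tau : K)
    (L r m e : nat) (A : 'I_L -> {poly K}) :
  f != 0 -> c != 0 -> exact_power_order f L -> (size f <= m.+1)%N ->
  (forall i, (size (A i) <= e.+1)%N) -> (L.-1 * m + L * e < r)%N ->
  ('X - tau%:P) ^+ r %| f * G ^+ L - c%:P ->
  ('X - tau%:P) ^+ r %| \sum_i A i * G ^+ i ->
  forall i, A i = 0.
Proof.
move=> f0 c0 kf sf sA ltr dvB dvA.
(* the polynomial [\sum_i A i T ^ i]; the default [0] is never used for [i < L] *)
pose AT : {poly {poly K}} := \poly_(i < L) oapp A 0 (insub i).
have ATE (i : 'I_L) : AT`_i = A i by rewrite coef_poly ltn_ord valK.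
suff AT0 : AT = 0 by move=> i; rewrite -ATE AT0 coef0.
have hA : AT.[G] = \sum_i A i * G ^+ i.
  by rewrite horner_poly; apply: eq_bigr => i _; rewrite valK.
have sAT : (size AT <= L)%N by exact: size_poly.
have sAj j : (size (AT`_j)%R <= e.+1)%N.
  have [jL|Lj] := ltnP j L; first by rewrite -[j]/(val (Ordinal jL)) ATE.
  by rewrite nth_default ?size_poly0 // (leq_trans sAT).
have sX : size (('X - tau%:P) ^+ r) = r.+1 by rewrite size_exp_XsubC.
apply/eqP/negPn/negP => AT0.
have L0 : (0 < L)%N by apply: leq_trans sAT; rewrite size_poly_gt0.
have er : (e < r)%N.
  by apply: leq_ltn_trans ltr; rewrite (leq_trans (leq_pmull e L0)) // leq_addl.
have := resultant_radical_neq0 f0 c0 kf AT0 sAT.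
set B := f%:P * 'X^L - c%:P%:P; set res := resultant B AT => res0.
have BE j : B`_j = (if j == L then f else 0) - (if j == 0%N then c%:P else 0).
  by rewrite coefB coefCM coefXn coefC; case: (j == L); rewrite ?mulr1 ?mulr0.
have sB : size B = L.+1.
  rewrite size_polyDl ?size_polyN size_Cmul ?size_polyXn // size_polyC polyC_eq0.
  by rewrite c0 ltnS.
have sBj j : (size (B`_j)%R <= m.+1)%N.
  rewrite BE; have sc : (size c%:P <= m.+1)%N by apply: leq_trans (size_polyC_leq1 _) _.
  by do 2![case: eqP => _]; rewrite ?subr0 ?sub0r ?size_polyN ?size_poly0 //;
    apply: leq_trans (size_polyD _ _) _; rewrite size_polyN geq_max sf.
have sres : (size res <= r)%N.
  apply: leq_trans (size_resultant_leq sBj sAj) _; rewrite sB /=.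
  by apply: leq_ltn_trans ltr; rewrite leq_add2r leq_mul2r -!subn1 leq_sub2r ?orbT.
suff /(dvdp_leq res0) : ('X - tau%:P) ^+ r %| res by rewrite sX ltnNge sres.
(* [resultant_in_ideal] asks for polynomials of positive degree in [T]. *)
have [s1|s1] := leqP (size AT) 1.
  move: dvA; rewrite -hA; move/size1_polyC: s1 (AT0) => -> .
  rewrite hornerC polyC_eq0 => A0 /(dvdp_leq A0).
  by rewrite sX leqNgt ltnS (leq_trans (sAj 0%N)).
have sB1 : (1 < size B)%N by rewrite sB ltnS.
have [[u v] _ E] := resultant_in_ideal sB1 s1.
rewrite -[res](hornerC _ G) E hornerD !hornerM hA.
rewrite hornerD hornerN !hornerM !hornerC hornerXn.
by rewrite dvdp_add // dvdp_mull.
Qed.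

(** * The polynomial method of Stepanov and Bombieri *)

Lemma poly_lin_dep (K : fieldType) (I : finType) (v : I -> {poly K}) (E : nat) :
  (forall i, (size (v i) <= E)%N) -> (E < #|I|)%N ->
  exists c : I -> K, (exists i, c i != 0) /\ \sum_i c i *: v i = 0.
Proof.
move=> sv ltE.
pose ev (k : 'I_#|I|) : I := enum_val k.
pose M := \matrix_(k < #|I|, j < E) (v (ev k))`_j.
have : kermx M != 0.
  rewrite -mxrank_eq0 mxrank_ker subn_eq0 -ltnNge.
  by apply: leq_ltn_trans (rank_leq_col M) ltE.
rewrite -nz_row_eq0; set u := nz_row _ => u0.
have uM : u *m M = 0 by apply/sub_kermxP/nz_row_sub.
exists (fun i => u 0 (enum_rank i)); split.
  have /rV0Pn[k uk] := u0; exists (enum_val k); by rewrite enum_valK.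
apply/polyP => j; rewrite coef0 coef_sum.
have [jE|Ej] := ltnP j E; last first.
  by apply: big1 => i _; rewrite coefZ nth_default ?mulr0 // (leq_trans (sv i)).
move/rowP/(_ (Ordinal jE)): uM; rewrite !mxE => uMj; apply: etrans uMj.
rewrite (reindex ev) /=; last first.
  by exists enum_rank => x _; rewrite /ev ?enum_valK ?enum_rankK.
by apply: eq_bigr => k _; rewrite coefZ mxE /ev enum_valK.
Qed.

Section PcharPower.
Variables (R : comNzRingType) (r : nat).
Hypothesis rP : [pchar R].-nat r.

Lemma expr_sum_pchar (I : Type) (s : seq I) (F : I -> R) :
  (\sum_(i <- s) F i) ^+ r = \sum_(i <- s) F i ^+ r.
Proof.
apply: (big_morph (fun x => x ^+ r)); first by move=> x y; rewrite exprDn_pchar.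
by rewrite expr0n gtn_eqF //; case/andP: rP.
Qed.

Lemma exprBn_pchar (x y : R) : (x - y) ^+ r = x ^+ r - y ^+ r.
Proof. by rewrite exprDn_pchar // exprNn_pchar. Qed.
End PcharPower.

Lemma pnat_pchar_poly (K : fieldType) r :
  [pchar K].-nat r -> [pchar {poly K}].-nat r.
Proof. by apply: sub_in_pnat => p _; rewrite pchar_poly. Qed.

(** With [r = L t + 1] a power of the characteristic,
    [f * (f ^+ t) ^+ L = f ^+ r] is congruent to the constant [f.[tau] ^+ r]
    modulo [('X - tau) ^+ r], so [f ^+ t] plays the role of [G] in
    [radical_indep].  Reading the relation modulo successive powers of
    [('X - tau) ^+ r] kills the rows of [A] one after the other. *)
Lemma stepanov_indep (K : fieldType) (f : {poly K}) (tau : K)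
    (L t m e J : nat) (A : 'I_J -> 'I_L -> {poly K}) :
  [pchar K].-nat (L * t).+1 ->
  f.[tau] != 0 -> exact_power_order f L -> (size f <= m.+1)%N ->
  (forall j i, (size (A j i) <= e.+1)%N) -> (L.-1 * m + L * e < (L * t).+1)%N ->
  \sum_(j < J) ('X - tau%:P) ^+ ((L * t).+1 * j) * (\sum_(i < L) A j i * (f ^+ t) ^+ i) = 0 ->
  forall j i, A j i = 0.
Proof.
set r := (L * t).+1 => rP ft0 kf sf sA ltr H0 j.
have f0 : f != 0 by apply: contraNneq ft0 => ->; rewrite horner0.
elim/ltn_ind: {j}(val j) {-2}j (erefl (val j)) => n IH j Ej.
pose D := ('X - tau%:P) ^+ r.
have D0 : D != 0 by rewrite expf_neq0 // polyXsubC_eq0.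
apply: (radical_indep f0 _ kf sf (sA j) ltr (G := f ^+ t) (tau := tau)).
- exact: expf_neq0 r ft0.
- rewrite -exprM mulnC -exprS -/r rmorphXn /= -exprBn_pchar ?pnat_pchar_poly //.
  by rewrite dvdp_exp2r // dvdp_XsubCl // /root !hornerE subrr.
- move: H0; rewrite (bigD1 j) //= => /eqP; rewrite addr_eq0 => /eqP E.
  rewrite -/D -(@dvdp_mul2l _ (D ^+ j)) ?expf_neq0 ?polyXsubC_eq0 //.
  rewrite /D -!exprM E dvdpNr.
  apply: (big_rec (fun x => _ %| x)); first exact: dvdp0.
  move=> k x kj dx; rewrite dvdp_add //.
  have [ltkj|] := ltnP k j.
    rewrite big1 ?mulr0 ?dvdp0 // => i _.
    by rewrite (IH k) ?mul0r // -Ej.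
  rewrite leq_eqVlt eq_sym => /orP[/eqP/val_inj E'|ltjk]; first by rewrite E' eqxx in kj.
  by rewrite dvdp_mulr // -exprD dvdp_exp2l // -mulnSr leq_mul2l ltjk orbT.
Qed.

Lemma size_XnsubX (R : idomainType) n : (1 < n)%N -> size ('X^n - 'X : {poly R}) = n.+1.
Proof. by move=> n1; rewrite size_polyDl size_polyXn // size_polyN size_polyX. Qed.

Lemma nth_root_exists (K : closedFieldType) (n : nat) (c : K) :
  (0 < n)%N -> exists a, a ^+ n = c.
Proof.
move=> n0; have [|a] := @solve_monicpoly K n (nth 0 [:: c]); first by [].
rewrite (bigD1 (Ordinal n0)) //= expr0 mulr1 big1 ?addr0; first by exists a.
move=> [[|i] Hi] //= _; by rewrite nth_nil mul0r.
Qed.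

Lemma size_mul_leqS (K : fieldType) (p q : {poly K}) a b :
  (size p <= a.+1)%N -> (size q <= b.+1)%N -> (size (p * q)%R <= (a + b).+1)%N.
Proof.
move=> sp sq; apply: leq_trans (size_polyMleq _ _) _.
by rewrite -ltnS; move: sp sq; lia.
Qed.

Lemma size_exp_leqS (K : fieldType) (p : {poly K}) a n :
  (size p <= a.+1)%N -> (size (p ^+ n)%R <= (n * a).+1)%N.
Proof.
move=> sp; apply: leq_trans (size_poly_exp_leq _ _) _.
by rewrite ltnS mulnC leq_mul2l; apply/orP; right; move: sp; case: (size p).
Qed.

(** The auxiliary polynomial is
    [H = \sum_(i, j) A i j * ('X - tau) ^+ (r j) * f ^+ (t i)].  At a point
    [y] of [s] one has [(y - tau) ^+ (r ^ 2) = y - tau] and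
    [f.[y] ^+ (r t i) = b ^+ i * f.[y] ^- (t i)], so that
    [H.[y] ^+ r * f.[y] ^+ (t (L - 1))] is the value at [y] of a polynomial of
    low degree depending linearly on the [r]-th powers of the coefficients of
    the [A i j].  When there are more coefficients than its degree, these can
    be chosen, not all zero, to make that polynomial vanish identically; then
    [H] vanishes on [s], while [H != 0] by [stepanov_indep]. *)
Lemma stepanov_count (K : closedFieldType) (f : {poly K})
    (L t m e J : nat) (b : K) (s : seq K) :
  (1 < L)%N -> exact_power_order f L -> (size f <= m.+1)%N ->
  [pchar K].-nat (L * t).+1 -> uniq s ->
  (forall y, y \in s -> [/\ y ^+ ((L * t).+1 ^ 2) = y, f.[y] != 0
                        & f.[y] ^+ (t * (L * t).+2) = b]) ->
  (L.-1 * m + L * e < (L * t).+1)%N ->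
  (((L * t).+1 * e + J + t * L.-1 * m).+1 < L * J.+1 * e.+1)%N ->
  (size s <= e + (L * t).+1 * J + t * L.-1 * m)%N.
Proof.
set r := (L * t).+1 => L1 kf sf rP us hs ltr ltI.
(* any point of [s] will do as the base point [tau] *)
case: s us hs => [|tau s'] // us hs; set s := tau :: s' in us hs *.
have [tauQ ft0 _] := hs tau (mem_head _ _).
have f0 : f != 0 by apply: contraNneq ft0 => ->; rewrite horner0.
have r0 : (0 < r)%N by [].
pose I := ('I_J.+1 * 'I_L * 'I_e.+1)%type.
pose v (x : I) : {poly K} :=
  'X^(r * x.2) * ('X - tau%:P) ^+ x.1.1 * (b ^+ x.1.2 *: f ^+ (t * (L.-1 - x.1.2))).
have sXt : (size ('X - tau%:P)%R <= 2)%N by rewrite size_XsubC.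
have sv x : (size (v x) <= (r * e + J + t * L.-1 * m).+1)%N.
  apply: size_mul_leqS; first apply: size_mul_leqS.
  - by rewrite size_polyXn ltnS leq_mul2l -ltnS ltn_ord orbT.
  - by apply: leq_trans (size_exp_leqS _ sXt) _; rewrite muln1 ltn_ord.
  - apply: leq_trans (size_scale_leq _ _) _; apply: leq_trans (size_exp_leqS _ sf) _.
    by rewrite ltnS leq_mul2r leq_mul2l leq_subr !orbT.
have cI : ((r * e + J + t * L.-1 * m).+1 < #|{: I}|)%N.
  by rewrite !card_prod !card_ord (mulnC J.+1) //.
have [c [[x0 cx0] Hc]] := poly_lin_dep sv cI.
(* The linear system has solution [c]; the coefficients of [H] are [r]-th roots. *)
have /fin_all_exists[a Ha] : forall x, exists z, z ^+ r = c x.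
  by move=> x; apply: nth_root_exists.
pose A j i : {poly K} := \poly_(k < e.+1) a (j, i, inord k).
have AE j i (k : 'I_e.+1) : (A j i)`_k = a (j, i, k).
  by rewrite coef_poly ltn_ord inord_val.
pose H := \sum_(j < J.+1) ('X - tau%:P) ^+ (r * j) * (\sum_(i < L) A j i * (f ^+ t) ^+ i).
have H0 : H != 0.
  apply: contra_neq cx0 => /(stepanov_indep rP ft0 kf sf (fun j i => size_poly _ _) ltr).
  case: (x0) => [[j i] k] A0; rewrite -Ha -AE /A A0 coef0 expr0n.
  by rewrite gtn_eqF.
have sH : (size H <= (e + r * J + t * L.-1 * m).+1)%N.
  apply: leq_trans (size_sum _ _ _) _; apply/bigmax_leqP => j _.
  rewrite -addnA addnCA; apply: size_mul_leqS.
    apply: leq_trans (size_exp_leqS _ sXt) _.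
    by rewrite muln1 ltnS leq_mul2l -ltnS ltn_ord orbT.
  apply: leq_trans (size_sum _ _ _) _; apply/bigmax_leqP => i _.
  apply: size_mul_leqS; first exact: size_poly.
  rewrite -exprM; apply: leq_trans (size_exp_leqS _ sf) _.
  rewrite ltnS leq_mul2r leq_mul2l; apply/orP; right; apply/orP; right.
  by rewrite -ltnS prednK // (ltn_trans _ L1).
rewrite -ltnS; apply: leq_trans sH.
apply: max_poly_roots => //; apply/allP => y ys.
have [yQ fy0 fyb] := hs y ys.
have subQ : (y - tau) ^+ (r * r) = y - tau.
  by rewrite exprBn_pchar ?pnatM ?rP // mulnn yQ tauQ.
have Q0 : (\sum_x c x *: v x).[y] = 0 by rewrite Hc horner0.
have HyE : H.[y] = \sum_(x : I)
    a x * y ^+ x.2 * (y - tau) ^+ (r * x.1.1) * f.[y] ^+ (t * x.1.2).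
  transitivity (\sum_(j < J.+1) \sum_(i < L) \sum_(k < e.+1)
      a (j, i, k) * y ^+ k * (y - tau) ^+ (r * j) * f.[y] ^+ (t * i)).
    rewrite horner_sum; apply: eq_bigr => j _.
    rewrite hornerM horner_exp !hornerE horner_sum mulr_sumr; apply: eq_bigr => i _.
    rewrite hornerM !horner_exp -exprM horner_poly mulr_suml mulr_sumr.
    by apply: eq_bigr => k _; rewrite inord_val mulrA; congr (_ * _); rewrite mulrC.
  by rewrite pair_big pair_big; apply: eq_bigr => -[[j i] k].
have : H.[y] ^+ r * f.[y] ^+ (t * L.-1) = 0.
  rewrite -Q0 HyE expr_sum_pchar // mulr_suml horner_sum.
  apply: eq_bigr => -[[j i] k] _ /=; rewrite /v /=.
  rewrite hornerZ !hornerM hornerXn hornerZ !horner_exp hornerXsubC !exprMn Ha -!exprM.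
  rewrite (mulnC k r) (mulnAC r j r) [(y - tau) ^+ (r * r * j)]exprM subQ.
  rewrite -!mulrA; do 3!congr (_ * _).
  rewrite -fyb -!exprM -!exprD; congr (_ ^+ _).
  have iL : (i <= L.-1)%N by rewrite -ltnS prednK // (ltn_trans _ L1).
  by rewrite -{1}(subnKC iL); move: (L.-1 - i)%N => w; nia.
move/eqP; rewrite mulf_eq0 !expf_eq0 (negPf fy0) andbF orbF.
by case/andP.
Qed.

(** This and the next two inequalities are the numerical conditions on the
    auxiliary polynomial, with [L = l + 2], [m = n + 1] a bound on the degree
    of [f], [t = u + 2 m + 2], [e = t - m - 1] and [J = t + 2 m - 1].  In each
    of them the difference of the two sides is a polynomial in [l], [u], [n]
    with nonnegative coefficients. *)
Lemma stepanov_nonvanishing_bound (l u n : nat) :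
  ((l + 1) * (n + 1) + (l + 1).+1 * (u + n + 2) < ((l + 1).+1 * (u + 2 * (n + 1) + 2)).+1)%N.
Proof.
rewrite ltnS; set X := (X in (X <= _)%N); set Y := (Y in (_ <= Y)%N).
suff -> : Y = (X + (l + n + 3))%N by rewrite leq_addr.
by rewrite /X /Y; lia.
Qed.

Lemma stepanov_unknowns_bound (l u n : nat) :
  ((((l + 1).+1 * (u + 2 * (n + 1) + 2)).+1 * (u + n + 2) + (u + 4 * n + 5)
    + (u + 2 * (n + 1) + 2) * (l + 1) * (n + 1)).+1
   < (l + 1).+1 * (u + 4 * n + 5).+1 * (u + n + 2).+1)%N.
Proof.
set X := (X in (X < _)%N); set Y := (Y in (_ < Y)%N).
suff -> : Y = (X + (l * u * n + 2 * l * u + 4 * l * n + 6 * l + 3 * u * n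
                + 3 * u + 2 * n * n + 9 * n + 7)).+1 by rewrite ltnS leq_addr.
by rewrite /X /Y; lia.
Qed.

Lemma stepanov_degree_bound (l u n : nat) :
  ((l + 1).+1 * (u + n + 2 + ((l + 1).+1 * (u + 2 * (n + 1) + 2)).+1 * (u + 4 * n + 5)
                 + (u + 2 * (n + 1) + 2) * (l + 1) * (n + 1))
   <= ((l + 1).+1 * (u + 2 * (n + 1) + 2)).+1 ^ 2
      + ((l + 1).+1 * ((l + 1).+1 * (2 * (n + 1) + 2)).+1 + (l + 1).+1 * 3 * (n + 1))
        * ((l + 1).+1 * (u + 2 * (n + 1) + 2)).+1)%N.
Proof.
rewrite -mulnn; set X := (X in (X <= _)%N); set Y := (Y in (_ <= Y)%N).
suff -> : Y = (X + (2 * l * l * l * u * n + 4 * l * l * l * u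
  + 4 * l * l * l * n * n + 16 * l * l * l * n + 16 * l * l * l
  + 12 * l * l * u * n + 26 * l * l * u + 24 * l * l * n * n + 102 * l * l * n
  + 108 * l * l + 25 * l * u * n + 57 * l * u + 50 * l * n * n + 224 * l * n
  + 249 * l + 18 * u * n + 42 * u + 36 * n * n + 168 * n + 195))%N
  by rewrite leq_addr.
by rewrite /X /Y; lia.
Qed.

(** Here [r = L t + 1] and [t (r + 1) = (r ^ 2 - 1) / L].  On the field with
    [r ^ 2] elements the [L]-th power residue symbol of [f] would take each of
    its values about [r ^ 2 / L] times if it were equidistributed; no value is
    taken more often, up to [O(r)]. *)
Lemma stepanov (K : closedFieldType) (f : {poly K}) (L : nat) :
  (1 < L)%N -> f != 0 -> exact_power_order f L ->
  exists C : nat, forall (t : nat) (b : K) (s : seq K),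
  (0 < t)%N -> [pchar K].-nat (L * t).+1 -> uniq s ->
  (forall y, y \in s -> [/\ y ^+ ((L * t).+1 ^ 2) = y, f.[y] != 0
                        & f.[y] ^+ (t * (L * t).+2) = b]) ->
  (L * size s <= (L * t).+1 ^ 2 + C * (L * t).+1)%N.
Proof.
move=> L1 f0 kf; pose m := size f.
have m0 : (0 < m)%N by rewrite size_poly_gt0.
exists (L * (L * (2 * m + 2)).+1 + L * 3 * m)%N => t b s t0 rP us hs.
have [tm|tm] := leqP (2 * m + 2) t; last first.
  (* The points are roots of ['X^(r ^ 2) - 'X]; for bounded [t] this is enough. *)
  have sz : (size s <= (L * t).+1 ^ 2)%N.
    have Q1 : (1 < (L * t).+1 ^ 2)%N.
      by rewrite -[1%N](exp1n 2) ltn_exp2r // ltnS muln_gt0 t0 ltnW.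
    have sQ := size_XnsubX K Q1.
    rewrite -ltnS -sQ; apply: max_poly_roots => //; first by rewrite -size_poly_gt0 sQ.
    by apply/allP => y /hs[yQ _ _]; rewrite /root !hornerE yQ subrr.
  apply: leq_trans (leq_mul (leqnn L) sz) _; rewrite mulnDl.
  apply: leq_trans (leq_addl _ _); apply: leq_trans (leq_addr _ _).
  rewrite -mulnn mulnA leq_mul2r leq_mul2l ltnS leq_mul2l (ltnW tm).
  by rewrite !orbT.
(* Parameters of the construction: [e = t - m - 1] and [J + 1 = t + 2 m]. *)
have [n Em] : exists n, m = (n + 1)%N by exists m.-1; rewrite addn1 prednK.
have [u Et] : exists u, t = (u + 2 * m + 2)%N.
  by exists (t - (2 * m + 2))%N; rewrite -addnA subnK.
have [l El] : exists l, L = (l + 1).+1.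
  by exists L.-2; move: L1; case: (L) => [|[|w]] //= _; rewrite addn1.
have Ee : (t - m - 1 = u + n + 2)%N by lia.
have EJ : (t + 2 * m).-1 = (u + 4 * n + 5)%N by lia.
have c1 : (L.-1 * m + L * (t - m - 1) < (L * t).+1)%N.
  rewrite Ee Et El Em; exact: stepanov_nonvanishing_bound.
have c2 : (((L * t).+1 * (t - m - 1) + (t + 2 * m).-1 + t * L.-1 * m).+1
            < L * (t + 2 * m).-1.+1 * (t - m - 1).+1)%N.
  rewrite Ee EJ Et El Em; exact: stepanov_unknowns_bound.
have := stepanov_count L1 kf (leqnSn _) rP us hs c1 c2 => sz.
apply: leq_trans (leq_mul (leqnn L) sz) _.
rewrite -/m Ee EJ Et El Em; exact: stepanov_degree_bound.
Qed.

(** * Frobenius and descent to a finite subfield *)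

Lemma card_finField_pnat (F : finFieldType) (K : fieldType)
  (iota : {rmorphism F -> K}) : [pchar K].-nat #|F|.
Proof.
have [p pp pF] := finPcharP F.
have E : #|F| = (p ^ logn p #|F|)%N by exact: (card_pprimeChar pF).
have pK : p \in [pchar K] by rewrite (fmorph_pchar iota).
by rewrite E pnatX pnatE // pK.
Qed.

Definition frob (F : finFieldType) (K : fieldType)
  (iota : {rmorphism F -> K}) (x : K) : K := x ^+ #|F|.

Section FrobMorph.
Variables (F : finFieldType) (K : fieldType) (iota : {rmorphism F -> K}).

Fact frob_is_zmod_morphism : zmod_morphism (frob iota).
Proof. by move=> x y; rewrite /frob exprBn_pchar ?(card_finField_pnat iota). Qed.

Fact frob_is_monoid_morphism : monoid_morphism (frob iota).
Proof. by split=> [|x y]; rewrite /frob ?expr1n ?exprMn. Qed.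

HB.instance Definition _ :=
  GRing.isZmodMorphism.Build K K (frob iota) frob_is_zmod_morphism.
HB.instance Definition _ :=
  GRing.isMonoidMorphism.Build K K (frob iota) frob_is_monoid_morphism.

End FrobMorph.

Section FiniteSubfield.
Variables (F : finFieldType) (K : fieldType) (iota : {rmorphism F -> K}).
Local Notation q := #|F|.
Local Notation sg := (frob iota).

Lemma card_finField_gt1 : (1 < q)%N. Proof. exact: finNzRing_gt1. Qed.

Lemma frobE x : sg x = x ^+ q. Proof. by []. Qed.

Lemma frob_iota x : sg (iota x) = iota x.
Proof. by rewrite /frob -rmorphXn expf_card. Qed.

Lemma frob_fixedP z : sg z = z -> exists x, iota x = z.
Proof.
move=> zq; case: (boolP [exists x, iota x == z]) => [/existsP[x /eqP]|]; first by exists x.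
rewrite negb_exists => /forallP nz.
have sP := size_XnsubX K card_finField_gt1.
have : (size (z :: map iota (enum F)) < q.+1)%N.
  rewrite -sP; apply: max_poly_roots; first by rewrite -size_poly_gt0 sP.
    rewrite /= /root !hornerE -frobE zq subrr eqxx /=.
    apply/allP => _ /mapP[x _ ->]; by rewrite /root !hornerE -frobE frob_iota subrr.
  rewrite /= map_inj_uniq ?enum_uniq ?andbT; last exact: fmorph_inj.
  by apply/mapP => -[x _ E]; have := nz x; rewrite E eqxx.
by rewrite /= size_map -cardE ltnn.
Qed.

(** A left inverse of [iota], meaningful on its image, which is the set of
    fixed points of [frob iota]. *)
Definition descend (z : K) : F := odflt 0 [pick x | iota x == z].

Lemma descendK z : sg z = z -> iota (descend z) = z.
Proof.
move/frob_fixedP => [x Ex]; rewrite /descend; case: pickP => [y /eqP //|/(_ x)].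
by rewrite Ex eqxx.
Qed.

Lemma iotaK x : descend (iota x) = x.
Proof. by apply: (fmorph_inj iota); rewrite descendK // frob_iota. Qed.

Lemma descend0 : descend 0 = 0. Proof. by rewrite -(rmorph0 iota) iotaK. Qed.
Lemma descend1 : descend 1 = 1. Proof. by rewrite -(rmorph1 iota) iotaK. Qed.

Lemma descendM z w : sg z = z -> sg w = w -> descend (z * w) = descend z * descend w.
Proof.
move=> hz hw; apply: (fmorph_inj iota).
by rewrite rmorphM !descendK // rmorphM /= hz hw.
Qed.

Lemma descendX z n : sg z = z -> descend (z ^+ n) = descend z ^+ n.
Proof.
by move=> hz; apply: (fmorph_inj iota); rewrite rmorphXn !descendK // rmorphXn /= hz.
Qed.

Lemma descent_poly (p : {poly K}) :
  map_poly sg p = p -> map_poly iota (map_poly descend p) = p.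
Proof.
move=> hp; apply/polyP => i; rewrite coef_map coef_map_id0 ?descend0 //= descendK //.
by rewrite -[in LHS]coef_map hp.
Qed.

Lemma map_frob_iota (p : {poly F}) :
  map_poly sg (map_poly iota p) = map_poly iota p.
Proof. by apply/polyP => i; rewrite !coef_map /= frob_iota. Qed.

Lemma horner_frob (p : {poly F}) x :
  sg (map_poly iota p).[x] = (map_poly iota p).[sg x].
Proof. by rewrite -[in RHS]map_frob_iota horner_map. Qed.

Lemma mup_map_frob (p : {poly K}) x :
  p != 0 -> mup (sg x) (map_poly sg p) = mup x p.
Proof.
move=> p0; have p0' : map_poly sg p != 0 by rewrite map_poly_eq0.
apply/eqP; rewrite eqn_leq.
have E n : (n <= mup (sg x) (map_poly sg p))%N = (n <= mup x p)%N.
  rewrite !mup_geq // -[in RHS](dvdp_map sg) (rmorphXn (map_poly sg)) (rmorphB (map_poly sg)) /=.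
  by rewrite map_polyX map_polyC.
by rewrite -E leqnn E leqnn.
Qed.

Lemma mup_frob (p : {poly F}) x :
  p != 0 -> mup (sg x) (map_poly iota p) = mup x (map_poly iota p).
Proof.
by move=> p0; rewrite -[in LHS]map_frob_iota mup_map_frob ?map_poly_eq0.
Qed.

Lemma iter_frob n x : iter n sg x = x ^+ (q ^ n).
Proof. by elim: n => [|n /= ->]; rewrite ?expr1 // /frob -exprM -expnSr. Qed.

(** The norm from the extension of degree [n] to the field with [#|F|] elements
    is the power map with this exponent. *)
Definition norm_exp n := (\sum_(i < n) q ^ i)%N.

Lemma norm_expP n : (norm_exp n * q.-1)%N = (q ^ n).-1.
Proof. by rewrite /norm_exp predn_exp mulnC. Qed.

End FiniteSubfield.

Section StableRoots.
Variables (F : finFieldType) (K : fieldType) (iota : {rmorphism F -> K}).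
Local Notation q := #|F|.
Local Notation sg := (frob iota).

Variable rs : seq K.
Hypothesis urs : uniq rs.
Hypothesis srs : {in rs, forall x, sg x \in rs}.

Lemma perm_map_frob : perm_eq (map sg rs) rs.
Proof.
have u : uniq (map sg rs) by rewrite map_inj_uniq //; exact: fmorph_inj.
apply: uniq_perm => //.
have sub : {subset map sg rs <= rs} by move=> _ /mapP[x xr ->]; exact: srs.
by have [] := uniq_min_size u sub; rewrite ?size_map.
Qed.

Lemma big_frob (R : Type) (idx : R) (op : Monoid.com_law idx) (G : K -> R) :
  \big[op/idx]_(x <- rs) G (sg x) = \big[op/idx]_(x <- rs) G x.
Proof. by rewrite -[RHS](perm_big _ perm_map_frob) big_map. Qed.

Lemma mem_frob x : (sg x \in rs) = (x \in rs).
Proof.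
rewrite -(perm_mem perm_map_frob) mem_map //; exact: fmorph_inj.
Qed.

Lemma mem_frobX n x : (x ^+ (q ^ n) \in rs) = (x \in rs).
Proof. by rewrite -(iter_frob iota); elim: n => //= n IH; rewrite mem_frob. Qed.

Variable m : K -> nat.
Hypothesis hm : forall x, m (sg x) = m x.

(** A weight constant on Frobenius orbits gives a polynomial fixed by Frobenius,
    hence one with coefficients in [F]. *)
Lemma descent_prod :
  exists g : {poly F}, map_poly iota g = \prod_(x <- rs) ('X - x%:P) ^+ m x.
Proof.
eexists; apply: descent_poly; rewrite rmorph_prod /= -[RHS]big_frob.
by apply: eq_bigr => x _; rewrite rmorphXn rmorphB /= map_polyX map_polyC hm.
Qed.

Lemma frob_prod_horner (g : {poly F}) :
  let w := \prod_(x <- rs) (map_poly iota g).[x] ^+ m x in sg w = w.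
Proof.
rewrite /= rmorph_prod /= -[RHS]big_frob.
by apply: eq_bigr => x _; rewrite rmorphXn /= horner_frob hm.
Qed.
End StableRoots.

(** * Factorization over a closed field *)

Lemma sum_count_mem (T : eqType) (r rs : seq T) :
  uniq rs -> {subset r <= rs} -> (\sum_(x <- rs) count_mem x r)%N = size r.
Proof.
move=> u; elim: r => [|z r IH] sub; first by rewrite big1.
have zrs : z \in rs by apply: sub; rewrite mem_head.
rewrite /= big_split /= IH => [|x xr]; last by apply: sub; rewrite inE xr orbT.
rewrite (bigD1_seq z) //= eqxx big1 ?addn0 ?add1n // => x.
by rewrite eq_sym => /negPf->.
Qed.

Lemma prod_count_mem (R : comNzRingType) (T : eqType) (r rs : seq T) (G : T -> R) :
  uniq rs -> {subset r <= rs} ->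
  \prod_(x <- rs) G x ^+ count_mem x r = \prod_(x <- r) G x.
Proof.
move=> u; elim: r => [|z r IH] sub; first by rewrite big1 ?big_nil // => x; rewrite expr0.
have zrs : z \in rs by apply: sub; rewrite mem_head.
rewrite big_cons -IH => [|x xr]; last by apply: sub; rewrite inE xr orbT.
under eq_bigr do rewrite /= exprD.
rewrite big_split (bigD1_seq z) //= eqxx expr1 big1 ?mulr1 // => x.
by rewrite eq_sym => /negPf->; rewrite expr0.
Qed.

Section ClosedFactor.
Variables (K : closedFieldType) (p : {poly K}) (rs : seq K).
Hypothesis p0 : p != 0.
Hypothesis urs : uniq rs.
Hypothesis hrs : forall x, root p x -> x \in rs.

Lemma mup_closed : exists2 r : seq K,
  {subset r <= rs} & p = lead_coef p *: \prod_(x <- r) ('X - x%:P) /\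
    forall x, mup x p = count_mem x r.
Proof.
have [r Er] := closed_field_poly_normal p; exists r.
  move=> x xr; apply: hrs; rewrite Er rootZ ?lead_coef_eq0 //.
  by rewrite root_prod_XsubC.
split=> // x; rewrite [in LHS]Er -mul_polyC mupMr ?mu_prod_XsubC //.
by rewrite rootC lead_coef_eq0.
Qed.

Lemma closed_factor :
  p = lead_coef p *: \prod_(x <- rs) ('X - x%:P) ^+ mup x p.
Proof.
have [r sub [Er Em]] := mup_closed.
rewrite {1}Er; congr (_ *: _); rewrite -(prod_count_mem _ urs sub).
by apply: eq_bigr => x _; rewrite Em.
Qed.

Lemma sum_mup : (\sum_(x <- rs) mup x p)%N = (size p).-1.
Proof.
have [r sub [Er Em]] := mup_closed.
rewrite [in RHS]Er size_scale ?lead_coef_eq0 // size_prod_XsubC /=.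
by rewrite -(sum_count_mem urs sub); apply: eq_bigr => x _; rewrite Em.
Qed.
End ClosedFactor.

Lemma mup_prod_exp (K : fieldType) (rs : seq K) (m : K -> nat) x :
  uniq rs -> mup x (\prod_(y <- rs) ('X - y%:P) ^+ m y) = (if x \in rs then m x else 0%N).
Proof.
elim: rs => [|y rs IH] /=; first by rewrite big_nil mupNroot ?root1.
move=> /andP[yrs u]; rewrite big_cons mupM ?IH // ?mup_XsubCX; last first.
- by rewrite prodf_seq_neq0; apply/allP => z _; rewrite expf_neq0 // polyXsubC_eq0.
- by rewrite expf_neq0 // polyXsubC_eq0.
rewrite inE eq_sym; case: eqP => [->|_] //=.
by rewrite (negPf yrs) addn0.
Qed.

(** * Points over the finite extensions of [F] *)

Section ExtensionPoints.
Variables (F : finFieldType) (K : closedFieldType) (iota : {rmorphism F -> K}).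
Local Notation q := #|F|.
Local Notation sg := (frob iota).

Definition ext_points (n : nat) : seq K := distinct_roots ('X^(#|F| ^ n) - 'X : {poly K}).

Lemma uniq_ext_points n : uniq (ext_points n). Proof. exact: undup_uniq. Qed.

Lemma card_expn_gt1 n : (0 < n)%N -> (1 < q ^ n)%N.
Proof. by move=> n0; rewrite -(exp1n n) ltn_exp2r // card_finField_gt1. Qed.

Lemma mem_ext_points n y : (0 < n)%N -> (y \in ext_points n) = (y ^+ (q ^ n) == y).
Proof.
move=> n0; rewrite mem_distinct_roots.
  by rewrite /root !hornerE subr_eq0.
by rewrite -size_poly_gt0 size_XnsubX // card_expn_gt1.
Qed.

Lemma size_ext_points n : (0 < n)%N -> size (ext_points n) = (q ^ n)%N.
Proof.
move=> n0; have Q1 := card_expn_gt1 n0; rewrite /ext_points /distinct_roots.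
case: closed_field_poly_normal => r /= Er.
have sP := size_XnsubX K Q1.
have l0 : lead_coef ('X^(q ^ n) - 'X : {poly K}) != 0.
  by rewrite lead_coef_eq0 -size_poly_gt0 sP.
rewrite undup_id.
  by move: sP; rewrite Er size_scale // size_prod_XsubC => -[].
rewrite -separable_prod_XsubC -(eqp_separable (eqp_scale _ l0)) -Er.
rewrite unlock derivB derivXn derivX.
have -> : 'X^((q ^ n).-1) *+ (q ^ n)%N = 0 :> {poly K}.
  rewrite -scaler_nat; have : (q ^ n)%:R = 0 :> K.
    have [p pp pF] := finPcharP F.
    have pK : p \in [pchar K] by rewrite (fmorph_pchar iota).
    apply/eqP; rewrite -(dvdn_pcharf pK) Euclid_dvdX // n0 andbT.
    have E : q = (p ^ logn p q)%N by exact: (card_pprimeChar pF).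
    by rewrite E Euclid_dvdX // dvdnn lt0n; apply/eqP => k0;
      move: (card_finField_gt1 F); rewrite E k0.
  by move->; rewrite scale0r.
by rewrite sub0r -[X in coprimep _ X]scaleN1r coprimepZr ?oppr_eq0 ?oner_eq0 // coprimep1.
Qed.

End ExtensionPoints.

(** * Multiplicative characters *)

Section Chi.
Variables (F : finFieldType) (theta : {unit F}).
Hypothesis gen : generator [set: {unit F}] theta.
Local Notation q := #|F|.

Definition chi (zeta : algC) (x : F) : algC :=
  if x == 0 then 0 else zeta ^+ dlog theta x.

Lemma val_theta_neq0 : val theta != 0.
Proof. by rewrite -unitfE; exact: valP theta. Qed.

Lemma val_thetaX_eq i j :
  val theta ^+ i = val theta ^+ j -> i = j %[mod q.-1].
Proof.
move/eqP: gen => gE.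
have ord : #[theta]%g = q.-1 by rewrite orderE -gE card_finField_unit.
rewrite -!FinRing.val_unitX => /val_inj/eqP.
by rewrite eq_expg_mod_order ord => /eqP.
Qed.

Lemma dlogK x : x != 0 -> val theta ^+ dlog theta x = x.
Proof. by move=> x0; have [] := dlogP gen x0. Qed.

Lemma dlogM x y : x != 0 -> y != 0 ->
  dlog theta (x * y) = dlog theta x + dlog theta y %[mod q.-1].
Proof.
by move=> x0 y0; apply: val_thetaX_eq; rewrite exprD !dlogK ?mulf_neq0.
Qed.

Variables (L : nat) (zeta : algC).
Hypothesis Lq : (L %| q.-1)%N.
Hypothesis zP : L.-primitive_root zeta.
Local Notation ch := (chi zeta).

Lemma eq_modL i j : i = j %[mod q.-1] -> i = j %[mod L].
Proof.
by move=> E; rewrite -(modn_dvdm i Lq) E modn_dvdm.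
Qed.

Lemma zeta_expr_eq i j : i = j %[mod L] -> zeta ^+ i = zeta ^+ j.
Proof. by move=> E; apply/eqP; rewrite (eq_prim_root_expr zP) E. Qed.

Lemma chiM x y : ch (x * y) = ch x * ch y.
Proof.
rewrite /chi mulf_eq0; case: (eqVneq x 0) => [|x0]; first by rewrite mul0r.
case: (eqVneq y 0) => [|y0] /=; first by rewrite mulr0.
by rewrite -exprD; apply/zeta_expr_eq/eq_modL/dlogM.
Qed.

Lemma zeta_neq0 : zeta != 0.
Proof.
apply/eqP => z0; have := prim_expr_order zP.
by rewrite z0 expr0n gtn_eqF ?(prim_order_gt0 zP) // => /esym/eqP; rewrite oner_eq0.
Qed.

Lemma chi1 : ch 1 = 1.
Proof.
have z0 : ch 1 != 0.
  by rewrite /chi oner_eq0 expf_neq0 // zeta_neq0.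
by apply: (mulfI z0); rewrite -chiM !mulr1.
Qed.

Lemma chiX x n : ch (x ^+ n) = ch x ^+ n.
Proof. by elim: n => [|n IH]; rewrite ?chi1 // !exprS chiM IH. Qed.

Lemma norm_chi x : x != 0 -> `|ch x| = 1.
Proof.
move=> x0; rewrite /chi (negPf x0) normrX.
suff -> : `|zeta| = 1 by rewrite expr1n.
apply/eqP; rewrite -(@pexpr_eq1 _ _ L) ?(prim_order_gt0 zP) //.
by rewrite -normrX (prim_expr_order zP) normr1.
Qed.

End Chi.

Lemma sumr_const_seq (V : zmodType) (I : Type) (r : seq I) (P : pred I) (x : V) :
  \sum_(i <- r | P i) x = x *+ count P r.
Proof. by rewrite big_const_seq iter_addr_0. Qed.

Lemma norm_exp_frob (F : finFieldType) n : (norm_exp F n * #|F| + 1 = norm_exp F n + #|F| ^ n)%N.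
Proof.
have := norm_expP F n; have := card_finField_gt1 F.
have : (0 < #|F| ^ n)%N by rewrite expn_gt0 ltnW // card_finField_gt1.
move: (norm_exp F n) (#|F| ^ n)%N (#|F|) => e Q [|q] //= Q0 q1 E; nia.
Qed.

Section NormFixed.
Variables (F : finFieldType) (K : fieldType) (iota : {rmorphism F -> K}).

Lemma frob_norm z n : z ^+ (#|F| ^ n) = z -> (0 < n)%N ->
  frob iota (z ^+ norm_exp F n) = z ^+ norm_exp F n.
Proof.
move=> zq n0; rewrite /frob -exprM.
have [->|z0] := eqVneq z 0.
  have E0 : (0 < norm_exp F n)%N.
    by case: n n0 {zq} => // n _; rewrite /norm_exp big_ord_recl addn_gt0.
  have E1 : (0 < norm_exp F n * #|F|)%N by rewrite muln_gt0 E0 ltnW // card_finField_gt1.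
  by rewrite !expr0n !gtn_eqF.
apply: (mulIf z0); rewrite -exprSr -addn1 norm_exp_frob exprD zq //.
Qed.
End NormFixed.

(** * Square-root size of character sums over even extensions *)

(** If no class exceeds its expected share by much, and the total is almost the
    sum of the shares, then all classes are close to their share; since the
    powers of [xi] sum to zero, only the deviations contribute. *)
Lemma sum_unity_equidistributed (d : nat) (xi : algC) (N : 'I_d -> nat) (B M : nat) :
  xi ^+ d = 1 -> xi != 1 -> (forall i, d * N i <= B)%N ->
  (d * B <= d * M + d * \sum_i N i)%N ->
  `|\sum_(i < d) xi ^+ i *+ N i| <= M%:R.
Proof.
move=> xid xi1 NB BM.
have [d0|d0] := posnP d.
  by subst d; rewrite big_ord0 normr0 ler0n.
have nxi : `|xi| = 1 by apply/eqP; rewrite -(@pexpr_eq1 _ _ d) // -?normrX ?xid ?normr1.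
have s0 : \sum_(i < d) xi ^+ i = 0.
  apply: (mulfI (x := xi - 1)); first by rewrite subr_eq0.
  by rewrite -subrX1 xid subrr mulr0.
rewrite -(ler_pM2l (x := d%:R)) ?ltr0n // -{1}[d%:R]normr_nat -normrM.
have -> : d%:R * (\sum_(i < d) xi ^+ i *+ N i) = - \sum_(i < d) xi ^+ i *+ (B - d * N i).
  apply/eqP; rewrite -addr_eq0 mulr_sumr -big_split /=.
  rewrite (eq_bigr (fun i : 'I_d => xi ^+ i *+ B)); first by rewrite sumrMnl s0 mul0rn.
  by move=> i _; rewrite mulr_natl -mulrnA -mulrnDr mulnC subnKC // mulnC.
rewrite normrN; apply: le_trans (ler_norm_sum _ _ _) _.
have -> : \sum_(i < d) `|xi ^+ i *+ (B - d * N i)| = (\sum_(i < d) (B - d * N i)%N)%:R.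
  rewrite natr_sum; apply: eq_bigr => i _.
  by rewrite normrMn normrX nxi expr1n.
rewrite -natrM ler_nat -(leq_add2r (\sum_(i < d) d * N i)%N) -big_split /=.
under eq_bigr do rewrite subnK //.
by rewrite sum_nat_const card_ord -big_distrr /=.
Qed.

Lemma expf_card_pred (F : finFieldType) (x : F) : x != 0 -> x ^+ #|F|.-1 = 1.
Proof.
move=> x0; apply: (mulfI x0); rewrite -exprS prednK ?expf_card ?mulr1 //.
exact: ltnW (card_finField_gt1 F).
Qed.

Section CharSum.
Variables (F : finFieldType) (theta : {unit F}).
Hypothesis gen : generator [set: {unit F}] theta.
Variables (K : closedFieldType) (iota : {rmorphism F -> K}).
Variables (L : nat) (zeta : algC).
Hypothesis Lq : (L %| #|F|.-1)%N.
Hypothesis zP : L.-primitive_root zeta.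
Variables (f : {poly F}) (rs : seq K).
Hypothesis f0 : f != 0.
Hypothesis urs : uniq rs.
Hypothesis srs : {in rs, forall x, frob iota x \in rs}.
Local Notation fK := (map_poly iota f).
Hypothesis hrs : forall x, root fK x -> x \in rs.
Hypothesis nL : exists rho, ~~ (L %| mup rho fK)%N.
Local Notation q := #|F|.
Local Notation sg := (frob iota).

(** [d] is the order of [f] modulo constants and [L]-th powers.  It divides [L],
    and all multiplicities of [f] are then divisible by [e = L / d].  Replacing
    [f] by [g] and [L] by [d] reduces a character sum to one where the
    condition [exact_power_order] holds. *)
Lemma power_free_part : exists d e (g : {poly F}),
  [/\ (1 < d)%N, L = (e * d)%N, f = lead_coef f *: g ^+ e, g != 0
    & exact_power_order (map_poly iota g) d].
Proof.
have L0 : (0 < L)%N := prim_order_gt0 zP.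
have fK0 : fK != 0 by rewrite map_poly_eq0.
pose m x := mup x fK.
have mrs x : x \notin rs -> m x = 0%N.
  by move=> xr; apply: mupNroot; apply: contra xr; apply: hrs.
pose Q d := (0 < d)%N && all (fun x => L %| d * m x)%N rs.
have exQ : exists d, Q d by exists L; rewrite /Q L0; apply/allP => x _; rewrite dvdn_mulr.
case: (ex_minnP exQ) => d /andP[d0 /allP Qd] dmin.
have {}Qd x : (L %| d * m x)%N.
  by case: (boolP (x \in rs)) => [/Qd //|/mrs->]; rewrite muln0.
have d1 : (1 < d)%N.
  rewrite ltn_neqAle d0 andbT eq_sym; apply/eqP => d1.
  have [rho] := nL; by have := Qd rho; rewrite d1 mul1n /m => ->.
have dL : (d %| L)%N.
  rewrite /dvdn; apply/eqP; case: (posnP (L %% d)%N) => // r0.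
  suff /dmin : Q (L %% d)%N by rewrite leqNgt ltn_pmod.
  rewrite /Q r0; apply/allP => x _.
  have := dvdn_mulr (m x) (dvdnn L); rewrite {2}(divn_eq L d) mulnDl dvdn_addr //.
  by rewrite -mulnA dvdn_mull.
pose e := (L %/ d)%N.
have Led : L = (e * d)%N by rewrite divnK.
have em x : (e %| m x)%N.
  by have := Qd x; rewrite Led mulnC dvdn_pmul2l.
have mfrob x : (m (sg x) %/ e = m x %/ e)%N by rewrite /m mup_frob.
have [g Eg] := descent_prod urs srs mfrob.
have mg x : (m x = e * mup x (map_poly iota g))%N.
  rewrite Eg mup_prod_exp //; case: (boolP (x \in rs)) => [_|/mrs->].
    by rewrite mulnC divnK.
  by rewrite muln0.
exists d, e, g; split=> //.
- apply: (map_poly_inj iota); rewrite map_polyZ rmorphXn /= -lead_coef_map Eg.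
  rewrite -prodrXl [LHS](closed_factor fK0 urs hrs); congr (_ *: _).
  by apply: eq_bigr => x _; rewrite -exprM divnK // em.
- rewrite -(map_poly_eq0 iota) Eg prodf_seq_neq0; apply/allP => x _.
  by rewrite expf_neq0 // polyXsubC_eq0.
move=> k /andP[k0 kd].
have : ~~ Q k by apply/negP => /dmin; rewrite leqNgt kd.
rewrite /Q k0 /= -has_predC => /hasP[x _ /= nx]; exists x.
apply: contra nx => dk; rewrite mg Led mulnCA dvdn_pmul2l //.
by rewrite /e divn_gt0 // dvdn_leq.
Qed.

(** Over the field with [q ^ (2 n)] elements, the norm of [g.[y]] falls into one
    of [d] classes according to its logarithm modulo [d], and this class is
    determined by [g.[y] ^+ ((q ^ (2 n) - 1) / d)].  [stepanov], with
    [r = q ^ n], bounds each class from above, and together the classes contain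
    all points outside [rs]. *)
Lemma charsum_even_bound : exists C : nat, forall n, (0 < n)%N ->
  `|\sum_(y <- ext_points F K (2 * n) | y \notin rs)
      chi theta zeta (descend iota (fK.[y] ^+ norm_exp F (2 * n)))|
  <= (C * q ^ n)%:R.
Proof.
have [d [e [g [d1 Led Ef g0 kg]]]] := power_free_part.
have d0 : (0 < d)%N by apply: ltnW.
have gK0 : map_poly iota g != 0 by rewrite map_poly_eq0.
have [C HC] := stepanov d1 gK0 kg.
exists (C + size rs)%N => n n0.
pose gK := map_poly iota g; set E := norm_exp F _.
have n2 : (0 < 2 * n)%N by rewrite muln_gt0.
pose w y := descend iota (gK.[y] ^+ E).
have e0 : (0 < e)%N by move: (prim_order_gt0 zP); rewrite Led muln_gt0 => /andP[].
have dq1 : (d %| q.-1)%N by apply: dvdn_trans Lq; rewrite Led dvdn_mull.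
have dqn : (d %| (q ^ n).-1)%N by apply: (dvdn_trans dq1); rewrite predn_exp dvdn_mulr.
have qn0 : (0 < q ^ n)%N by rewrite expn_gt0 ltnW // card_finField_gt1.
pose t := ((q ^ n).-1 %/ d)%N.
have tE : (d * t).+1 = (q ^ n)%N by rewrite mulnC divnK // prednK.
have t0 : (0 < t)%N.
  rewrite divn_gt0 // dvdn_leq // -ltnS prednK //; exact: card_expn_gt1.
have gKF y : y \in ext_points F K (2 * n) -> sg (gK.[y] ^+ E) = gK.[y] ^+ E.
  rewrite mem_ext_points // => /eqP yq; apply: frob_norm => //.
  by rewrite -(iter_frob iota); rewrite -{2}yq -(iter_frob iota);
     elim: (2 * n)%N => //= k ->; rewrite horner_frob.
have gK_neq0 y : y \notin rs -> gK.[y] != 0.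
  apply: contraNneq => gy; apply: hrs; rewrite Ef map_polyZ rmorphXn /=.
  by rewrite /root hornerZ horner_exp -/gK gy expr0n gtn_eqF // mulr0.
have xiP : zeta ^+ e != 1.
  rewrite -(prim_order_dvd zP) Led; apply/negP => /dvdn_leq.
  by rewrite e0 => /(_ isT); rewrite -{2}[e]muln1 leq_pmul2l // leqNgt d1.
pose cls y := Ordinal (ltn_pmod (dlog theta (w y)) d0).
pose kap := chi theta zeta (descend iota (iota (lead_coef f) ^+ E)).
have lf0 : lead_coef f != 0 by rewrite lead_coef_eq0.
have nkap : `|kap| = 1.
  by rewrite /kap -rmorphXn iotaK (norm_chi theta zP) // expf_neq0.
have termE y : y \in ext_points F K (2 * n) -> y \notin rs ->
    chi theta zeta (descend iota (fK.[y] ^+ E)) = kap * (zeta ^+ e) ^+ cls y.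
  move=> yF yr; rewrite [in LHS]Ef map_polyZ rmorphXn /= hornerZ horner_exp -/gK.
  rewrite exprMn [gK.[y] ^+ e ^+ E]exprAC descendM; try by rewrite rmorphXn /= ?gKF ?frob_iota.
  rewrite (chiM gen Lq zP) -/kap; congr (_ * _).
  rewrite descendX ?gKF // (chiX gen Lq zP) -/(w y).
  have wy0 : w y != 0.
    rewrite -(fmorph_eq0 iota) descendK ?gKF // expf_neq0 //; exact: gK_neq0.
  rewrite /chi (negPf wy0) -/(cls y) -exprM mulnC exprM -[LHS](expr_mod _ (n := d)) //.
  by rewrite -exprM -Led (prim_expr_order zP).
pose N (i : 'I_d) := count (fun y => (y \notin rs) && (cls y == i)) (ext_points F K (2 * n)).
have -> : \sum_(y <- ext_points F K (2 * n) | y \notin rs)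
      chi theta zeta (descend iota (fK.[y] ^+ E))
    = kap * \sum_(i < d) (zeta ^+ e) ^+ i *+ N i.
  transitivity (\sum_(y <- ext_points F K (2 * n) | y \notin rs) kap * (zeta ^+ e) ^+ cls y).
    rewrite [LHS]big_seq_cond [RHS]big_seq_cond; apply: eq_bigr => y /andP[yF yr].
    exact: termE.
  rewrite -mulr_sumr (partition_big cls predT) //=; congr (_ * _).
  apply: eq_bigr => i _; rewrite (eq_bigr (fun _ => (zeta ^+ e) ^+ i)).
    exact: sumr_const_seq.
  by move=> y /andP[_ /eqP<-].
rewrite normrM nkap mul1r.
apply: (sum_unity_equidistributed (B := ((q ^ n) ^ 2 + C * q ^ n)%N)) => //.
- by rewrite -exprM -Led (prim_expr_order zP).
- move=> i; rewrite /N -size_filter -tE.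
  apply: (HC t (iota (val theta ^+ (i * (q.-1 %/ d))))) => //.
  + by rewrite tE pnatX (card_finField_pnat iota).
  + by rewrite filter_uniq // uniq_ext_points.
  move=> y; rewrite mem_filter => /andP[/andP[yr /eqP ycls] yF].
  have wy0 : w y != 0.
    by rewrite -(fmorph_eq0 iota) descendK ?gKF // expf_neq0 //; exact: gK_neq0.
  split; last 1 first.
  + have -> : (t * (d * t).+2 = E * (q.-1 %/ d))%N.
      have H1 : (d * (E * (q.-1 %/ d)) = ((d * t).+1 ^ 2).-1)%N.
        by rewrite mulnCA [(d * (_ %/ _))%N]mulnC divnK // norm_expP tE -expnM mulnC.
      apply/eqP; rewrite -(eqn_pmul2l d0) H1 mulnA; apply/eqP.
      by move: (d * t)%N => X; rewrite -mulnn mulSn addSn -pred_Sn; lia.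
    rewrite exprM -(descendK (gKF y yF)) -/(w y) -rmorphXn; congr (iota _).
    rewrite -{1}(dlogK gen wy0) -exprM -ycls /=.
    rewrite {1}(divn_eq (dlog theta (w y)) d) mulnDl exprD -mulnA [(d * (_ %/ _))%N]mulnC divnK //.
    by rewrite [(_ * q.-1)%N]mulnC exprM expf_card_pred ?val_theta_neq0 // expr1n mul1r.
  + by move: yF; rewrite mem_ext_points // tE -expnM mulnC => /eqP.
  + exact: gK_neq0.
rewrite -mulnDr leq_mul2l; apply/orP; right.
have -> : (\sum_i N i = count (fun y => y \notin rs) (ext_points F K (2 * n)))%N.
  rewrite -sum1_count (partition_big cls predT) //=.
  by apply: eq_bigr => i _; rewrite sum1_count.
have : (count (fun y => y \in rs) (ext_points F K (2 * n)) <= size rs)%N.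
  rewrite -size_filter; apply: uniq_leq_size; first by rewrite filter_uniq // uniq_ext_points.
  by move=> y; rewrite mem_filter => /andP[].
have := count_predC (fun y => y \in rs) (ext_points F K (2 * n)).
rewrite (size_ext_points iota) // mulnC expnM.
set a := count _ _; set b := count _ _ => <- le1.
have := leq_trans le1 (leq_pmulr (size rs) qn0).
rewrite mulnDl; lia.
Qed.
End CharSum.

(** * Newton identities *)

Definition psum (R : pzRingType) (s : seq R) (n : nat) : R := \sum_(w <- s) w ^+ n.

(** The logarithmic derivative of [1 - w 'X] times ['X] is minus the geometric
    series [\sum_j w ^+ j 'X^j]; truncating at degree [M] leaves a relation
    modulo ['X^(M.+1)]. *)
Lemma newton_dvd (R : fieldType) (s : seq R) (M : nat) :
  let P := \prod_(w <- s) (1 - w *: 'X) : {poly R} in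
  'X^(M.+1) %| 'X * P^`() + (\sum_(j < M) psum s j.+1 *: 'X^(j.+1)) * P.
Proof.
elim: s => [|w s IH] /=.
  rewrite big_nil derivC mulr0 add0r mulr1 big1 ?dvdp0 // => j _.
  by rewrite /psum big_nil scale0r.
rewrite big_cons; set P := \prod_(w <- s) _ in IH *.
have -> : \sum_(j < M) psum (w :: s) j.+1 *: 'X^(j.+1)
   = \sum_(j < M) (w *: 'X) ^+ j.+1 + \sum_(j < M) psum s j.+1 *: 'X^(j.+1).
  rewrite -big_split; apply: eq_bigr => j _.
  by rewrite /psum big_cons scalerDl exprZn.
set Q := \sum_(j < M) psum s _ *: _ in IH *.
have E : (\sum_(j < M) (w *: 'X) ^+ j.+1) * (1 - w *: 'X) = w *: 'X - (w *: 'X) ^+ M.+1 :> {poly R}.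
  have -> : \sum_(j < M) (w *: 'X) ^+ j.+1 = (w *: 'X) * \sum_(j < M) (w *: 'X) ^+ j :> {poly R}.
    by rewrite mulr_sumr; apply: eq_bigr => j _; rewrite exprS.
  rewrite -mulrA [X in _ * X]mulrC -opprB mulNr -subrX1 opprB mulrBr mulr1.
  by rewrite -exprS.
have -> : 'X * ((1 - w *: 'X) * P)^`() + (\sum_(j < M) (w *: 'X) ^+ j.+1 + Q) * ((1 - w *: 'X) * P)
  = (1 - w *: 'X) * ('X * P^`() + Q * P) - (w *: 'X) ^+ M.+1 * P.
  rewrite derivM derivB derivZ derivX derivC sub0r alg_polyC.
  rewrite [(_ + Q) * _]mulrDl [X in _ + (X + _)]mulrA E.
  rewrite -!mul_polyC; move: P^`() => P'; move: ((w%:P * 'X) ^+ M.+1) => T.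
  move: (w%:P) ('X : {poly R}) {E IH} => W X; move: P Q => A B; ring.
apply: dvdp_sub; first by rewrite dvdp_mull.
by rewrite exprZn -mul_polyC dvdp_mulr // dvdp_mull.
Qed.

Lemma newton_coef (R : fieldType) (s : seq R) (d : nat) :
  let P := \prod_(w <- s) (1 - w *: 'X) : {poly R} in
  d%:R * P`_d = - \sum_(j < d) psum s j.+1 * P`_(d - j.+1).
Proof.
move=> P; apply/eqP; rewrite -addr_eq0; apply/eqP.
have /dvdpP[w /(congr1 (fun p : {poly R} => p`_d))] := newton_dvd s d.
rewrite -/P coefMXn ltnSn coefD => E0; apply: etrans E0; congr (_ + _).
  rewrite coefXM; case: d => [|d] /=; first by rewrite mul0r.
  by rewrite coef_deriv mulr_natl.
rewrite mulr_suml coef_sum; apply: eq_bigr => j _.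
by rewrite -scalerAl coefZ coefXnM ltnNge ltn_ord.
Qed.

(** Newton's identities determine the [S n] recursively from the [c d], as
    [c 0 = 1]; the opposites of the power sums satisfy the same identities. *)
Lemma newton_unique (R : fieldType) (c S : nat -> R) (Z : nat) (s : seq R) :
  c 0%N = 1 -> (forall d, (Z <= d)%N -> c d = 0) ->
  (forall d, c d = (\prod_(w <- s) (1 - w *: 'X))`_d) ->
  (forall d, d%:R * c d = \sum_(j < d) S j.+1 * c (d - j.+1)%N) ->
  forall n, (0 < n)%N -> S n = - psum s n.
Proof.
move=> c0 cZ cE cS; elim/ltn_ind => -[//|n] IH _.
have := newton_coef s n.+1; rewrite /= -cE cS !big_ord_recr /= subnn c0.
rewrite -cE c0 !mulr1 opprD.
have -> : \sum_(i < n) S i.+1 * c (n.+1 - i.+1)%N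
  = - \sum_(i < n) psum s i.+1 * (\prod_(w <- s) (1 - w *: 'X))`_(n.+1 - i.+1).
  rewrite -sumrN; apply: eq_bigr => i _; rewrite IH ?ltnS // -cE mulNr //.
by move/addrI.
Qed.

Lemma poly_inv_roots (K : closedFieldType) (p : {poly K}) : p`_0 = 1 ->
  exists s : seq K, (size s <= (size p).-1)%N /\ p = \prod_(w <- s) (1 - w *: 'X).
Proof.
move=> p0; have [r Er] := closed_field_poly_normal p.
have pn0 : p != 0 by apply: contra_eq_neq p0 => ->; rewrite coef0 eq_sym oner_eq0.
have l0 : lead_coef p != 0 by rewrite lead_coef_eq0.
exists (map (fun b => b^-1) r); split.
  by rewrite size_map {1}Er size_scale // size_prod_XsubC.
have r0 b : b \in r -> b != 0.
  move=> br; apply: contra_eq_neq p0 => b0; rewrite -horner_coef0 Er hornerZ.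
  suff -> : (\prod_(z <- r) ('X - z%:P)).[0] = 0 by rewrite mulr0 eq_sym oner_eq0.
  by apply/eqP; rewrite -/(root _ _) root_prod_XsubC -b0.
rewrite big_map.
have E : \prod_(z <- r) ('X - z%:P) = (\prod_(z <- r) - z) *: \prod_(z <- r) (1 - z^-1 *: 'X).
  rewrite -mul_polyC rmorph_prod -big_split /=.
  rewrite [LHS]big_seq [RHS]big_seq; apply: eq_bigr => z /r0 z0.
  rewrite mul_polyC scalerBr scalerA mulNr mulfV // scaleN1r opprK.
  by rewrite addrC -mul_polyC mulr1 polyCN.
have : p`_0 = lead_coef p * \prod_(z <- r) - z.
  rewrite {1}Er E -horner_coef0 !hornerZ horner_prod [X in _ * (_ * X)]big1 ?mulr1 //.
  by move=> z _; rewrite hornerD hornerN hornerZ hornerX hornerC mulr0 subr0.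
by rewrite p0 {2}Er E scalerA => <-; rewrite scale1r.
Qed.

(** * Sums over monic polynomials *)

Section MonicPolys.
Variable F : finFieldType.

Definition monic_of d (v : 'rV[F]_d) : {poly F} := 'X^d + rVpoly v.

Lemma size_rVpoly_leq d (v : 'rV[F]_d) : (size (rVpoly v) <= d)%N.
Proof. exact: size_poly. Qed.

Lemma size_monic_of d (v : 'rV[F]_d) : size (monic_of v) = d.+1.
Proof. by rewrite size_polyDl size_polyXn // ltnS size_rVpoly_leq. Qed.

Lemma monic_of_monic d (v : 'rV[F]_d) : monic_of v \is monic.
Proof.
by rewrite monicE lead_coefDl ?lead_coefXn // size_polyXn ltnS size_rVpoly_leq.
Qed.

Lemma monic_of_onto d (p : {poly F}) : p \is monic -> size p = d.+1 ->
  monic_of (poly_rV (p - 'X^d) : 'rV_d) = p.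
Proof.
move=> pm sp; rewrite /monic_of poly_rV_K; first by rewrite addrC subrK.
apply/leq_sizeP => j dj; rewrite coefB coefXn.
move: dj; rewrite leq_eqVlt => /orP[/eqP<-|dj].
  by rewrite eqxx; move: (monicP pm); rewrite /lead_coef sp /= => ->; rewrite subrr.
by rewrite gtn_eqF // subr0 nth_default // sp.
Qed.

Lemma monic_of_inj d : injective (@monic_of d).
Proof. by move=> u v /addrI E; rewrite -[u]rVpolyK E rVpolyK. Qed.

(** Multiplication by [P] is a bijection from the monic polynomials of degree
    [d - j] to the monic multiples of [P] of degree [d]. *)
Lemma sum_monic_multiples (V : zmodType) (G : {poly F} -> V) (P : {poly F}) (j d : nat) :
  P \is monic -> size P = j.+1 -> (j <= d)%N ->
  \sum_(v : 'rV[F]_d | P %| monic_of v) G (monic_of v)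
  = \sum_(u : 'rV[F]_(d - j)) G (P * monic_of u).
Proof.
move=> Pm sP jd; have P0 := monic_neq0 Pm.
have mulE (u : 'rV[F]_(d - j)) :
    monic_of (poly_rV (P * monic_of u - 'X^d) : 'rV_d) = P * monic_of u.
  apply: monic_of_onto; first by rewrite monicMl // monic_of_monic.
  by rewrite size_monicM // ?monic_neq0 ?monic_of_monic // sP size_monic_of addSn addnS subnKC.
rewrite (reindex (fun u : 'rV[F]_(d - j) => poly_rV (P * monic_of u - 'X^d) : 'rV_d)) /=.
  apply: eq_big => [u|u _]; last by rewrite mulE.
  by rewrite mulE dvdp_mulr // inE.
exists (fun v => poly_rV (monic_of v %/ P - 'X^(d - j))) => u.
  by move=> _; rewrite mulE mulrC mulpK // /monic_of addrC addKr rVpolyK.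
rewrite inE => Pu; apply: monic_of_inj; rewrite mulE.
rewrite monic_of_onto ?divpKC //.
  by rewrite -(monicMl _ Pm) divpKC // monic_of_monic.
by rewrite size_divp // sP size_monic_of subSn.
Qed.

End MonicPolys.

Section Vanish.
Variables (F : finFieldType) (C : numFieldType) (lam : {poly F} -> C) (h g0 : {poly F}).
Hypothesis lamM : forall g g', lam (g * g') = lam g * lam g'.
Hypothesis lam_mod : forall g g', h %| g - g' -> lam g = lam g'.
Hypothesis h0 : h != 0.
Hypothesis g0h : coprimep g0 h.
Hypothesis lamg0 : lam g0 != 1.
Local Notation Z := (size h).-1.

(** Multiplication by [g0] permutes the residues modulo [h] and multiplies the
    sum by [lam g0], which differs from [1]. *)
Lemma residue_sum0 : \sum_(w : 'rV[F]_Z) lam (rVpoly w) = 0.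
Proof.
set T := \sum_w _.
suff : lam g0 * T = T.
  move/eqP; rewrite -subr_eq0 -[X in _ - X]mul1r -mulrBl mulf_eq0 subr_eq0.
  by rewrite (negPf lamg0) => /eqP.
have smod p : (size (p %% h)%R <= Z)%N.
  by rewrite -ltnS prednK ?ltn_modp // size_poly_gt0.
pose phi (w : 'rV[F]_Z) : 'rV[F]_Z := poly_rV ((g0 * rVpoly w) %% h).
have phi_inj : injective phi.
  move=> u v /(congr1 rVpoly); rewrite !poly_rV_K // => /eqP E.
  have : h %| g0 * (rVpoly u - rVpoly v).
    by rewrite mulrBr /dvdp modpD modpN subr_eq0.
  rewrite Gauss_dvdpr 1?coprimep_sym // => dv.
  apply: (can_inj rVpolyK); apply/eqP; rewrite -subr_eq0.
  apply: contraTT dv => nz; apply/negP => /(dvdp_leq nz); apply/negP; rewrite -ltnNge.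
  rewrite -linearB; apply: leq_ltn_trans (size_rVpoly_leq _) _.
  by rewrite ltn_predL size_poly_gt0.
rewrite mulr_sumr [RHS](reindex_inj phi_inj) /=; apply: eq_bigr => w _.
rewrite -lamM; apply: lam_mod; rewrite poly_rV_K //.
by rewrite {1}(divp_eq (g0 * rVpoly w) h) addrK dvdp_mull.
Qed.

Lemma shifted_residue_sum0 (a : {poly F}) : \sum_(w : 'rV[F]_Z) lam (a + rVpoly w) = 0.
Proof.
rewrite -[RHS]residue_sum0 [RHS](reindex_inj (addrI (poly_rV (a %% h)))) /=.
apply: eq_bigr => w _; apply: lam_mod.
rewrite linearD /= poly_rV_K; last first.
  by rewrite -ltnS prednK ?ltn_modp // size_poly_gt0.
by rewrite opprD addrACA subrr addr0 {1}(divp_eq a h) addrK dvdp_mull.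
Qed.

(** As [d] is at least the degree of [h], translation by a polynomial of degree
    less than that of [h] permutes the monic polynomials of degree [d]; so the
    sum is an average of complete sums over residues. *)
Lemma monic_sum0 d : (Z <= d)%N -> \sum_(v : 'rV[F]_d) lam (monic_of v) = 0.
Proof.
move=> Zd; pose up (w : 'rV[F]_Z) : 'rV[F]_d := poly_rV (rVpoly w).
have upE w : rVpoly (up w) = rVpoly w.
  by rewrite poly_rV_K // (leq_trans (size_poly _ _)).
have : (\sum_(v : 'rV[F]_d) lam (monic_of v)) *+ #|{: 'rV[F]_Z}| = 0.
  rewrite -sumr_const.
  rewrite (eq_bigr (fun w => \sum_(v : 'rV[F]_d) lam (monic_of v + rVpoly w))); last first.
    move=> w _; rewrite (reindex_inj (addrI (up w))) /=; apply: eq_bigr => v _.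
    by rewrite /monic_of linearD /= upE addrCA addrC.
  by rewrite exchange_big big1 //= => v _; rewrite shifted_residue_sum0.
move/eqP; rewrite mulrn_eq0 card_mx => /orP[|/eqP//].
by rewrite expn_eq0 => /andP[/eqP E]; have := card_finField_gt1 F; rewrite E.
Qed.
End Vanish.

(** * Norms of points, and the divisors of a monic polynomial *)

(** For an increasing enumeration [0 = a_0 < a_1 < ...] of [A], the value of
    [kap] at [a_i] is [i]; the terms counted are [a_1, ..., a_e]. *)
Lemma count_returns (A : pred nat) (e D : nat) : A 0%N ->
  let kap j := (\sum_(i < j) A i)%N in
  (e < kap D.+1)%N ->
  (\sum_(j < D) (A j.+1 && (kap j.+1 <= e)))%N = e.
Proof.
move=> A0 kap.
suff H : (\sum_(j < D) (A j.+1 && (kap j.+1 <= e)))%N = minn e (kap D.+1).-1.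
  by move=> lt_e; rewrite H; apply/minn_idPl; rewrite -ltnS prednK // (leq_trans _ lt_e).
have kS j : kap j.+1 = (kap j + A j)%N by rewrite /kap big_ord_recr.
elim: D => [|D IH]; first by rewrite big_ord0 kS /kap big_ord0 A0 /= minn0.
rewrite big_ord_recr /= IH [kap D.+2]kS.
have : (0 < kap D.+1)%N by rewrite /kap big_ord_recl A0.
move: (kap D.+1) => k k0; case: (A D.+1) => /=; last by rewrite !addn0.
by rewrite addn1 /=; case: leqP => ke; rewrite /minn; do 2?case: ifP; lia.
Qed.

Lemma dvdp_mup (K : closedFieldType) (p r : {poly K}) : p != 0 -> r != 0 ->
  (forall x, root p x -> (mup x p <= mup x r)%N) -> p %| r.
Proof.
move=> p0 r0 le_pr; pose rs := distinct_roots (p * r).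
have urs : uniq rs by exact: undup_uniq.
have prs x : root p x -> x \in rs.
  by move=> px; rewrite mem_distinct_roots ?mulf_neq0 // rootM px.
have rrs x : root r x -> x \in rs.
  by move=> px; rewrite mem_distinct_roots ?mulf_neq0 // rootM px orbT.
rewrite (closed_factor p0 urs prs) (closed_factor r0 urs rrs).
rewrite dvdpZl ?lead_coef_eq0 // dvdpZr ?lead_coef_eq0 //.
apply: (big_ind2 (fun a b => a %| b)) => // [a b c e|x _]; first exact: dvdp_mul.
apply: dvdp_exp2l; have [/le_pr //|nr] := boolP (root p x).
by rewrite mupNroot.
Qed.

Section Norm.
Variables (F : finFieldType) (K : closedFieldType) (iota : {rmorphism F -> K}).
Local Notation q := #|F|.
Local Notation sg := (frob iota).

(** The product of ['X - z] over the conjugates of [y], each repeated as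
    required for a point of the extension of degree [n]. *)
Definition conj_poly (n : nat) (y : K) : {poly K} :=
  \prod_(i < n) ('X - (y ^+ (#|F| ^ i))%:P).

(** The characteristic polynomial of a point of the extension of degree [n];
    meaningful when [y ^+ (#|F| ^ n) = y], where it lifts [conj_poly]. *)
Definition norm_poly n y : {poly F} := map_poly (descend iota) (conj_poly n y).

Lemma conj_poly_seq n y :
  conj_poly n y = \prod_(x <- [seq y ^+ (q ^ i) | i <- seq.iota 0 n]) ('X - x%:P).
Proof. by rewrite big_map -[n in seq.iota _ n]subn0 -/(index_iota 0 n) big_mkord. Qed.

Lemma conj_poly_monic n y : conj_poly n y \is monic.
Proof. by apply: monic_prod => i _; exact: monicXsubC. Qed.

Lemma size_conj_poly n y : size (conj_poly n y) = n.+1.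
Proof. by rewrite conj_poly_seq size_prod_XsubC size_map size_iota. Qed.

Lemma frob_iter_point i y : sg (y ^+ (q ^ i)) = y ^+ (q ^ i.+1).
Proof. by rewrite frobE -exprM -expnSr. Qed.

Lemma map_frob_conj_poly n y : y ^+ (q ^ n) = y -> map_poly sg (conj_poly n y) = conj_poly n y.
Proof.
case: n => [|n] yq; first by rewrite /conj_poly big_ord0 rmorph1.
rewrite {1}/conj_poly rmorph_prod /= big_ord_recr [RHS]big_ord_recl /= mulrC.
congr (_ * _); first by rewrite rmorphB /= map_polyX map_polyC /= frob_iter_point yq expr1.
by apply: eq_bigr => i _; rewrite rmorphB /= map_polyX map_polyC /= frob_iter_point.
Qed.

Lemma map_norm_poly n y : y ^+ (q ^ n) = y -> map_poly iota (norm_poly n y) = conj_poly n y.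
Proof. by move=> yq; rewrite descent_poly // map_frob_conj_poly. Qed.

Lemma norm_poly_monic n y : y ^+ (q ^ n) = y -> norm_poly n y \is monic.
Proof. by move=> yq; rewrite -(map_monic iota) map_norm_poly // conj_poly_monic. Qed.

Lemma size_norm_poly n y : y ^+ (q ^ n) = y -> size (norm_poly n y) = n.+1.
Proof. by move=> yq; rewrite -(size_map_poly iota) map_norm_poly // size_conj_poly. Qed.

(** [y] lies in the extension of degree [i]; always true for [i = 0]. *)
Definition returns (y : K) i := y ^+ (q ^ i) == y.

Lemma mup_conj_poly n y : mup y (conj_poly n y) = (\sum_(i < n) returns y i)%N.
Proof.
rewrite conj_poly_seq mu_prod_XsubC count_map -sum1_count big_mkcond /=.
rewrite -[n in seq.iota _ n]subn0 -/(index_iota 0 n) big_mkord.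
by apply: eq_bigr => i _; rewrite /= /returns; case: eqP.
Qed.

(** Both polynomials have the same multiplicity at all conjugates of [y], and
    [norm_poly] has no other root, so it is enough to compare multiplicities at
    [y]. *)
Lemma norm_poly_dvd n y (g : {poly F}) : g != 0 -> y ^+ (q ^ n) = y ->
  (norm_poly n y %| g) = (\sum_(i < n) returns y i <= mup y (map_poly iota g))%N.
Proof.
move=> g0 yq; rewrite -mup_conj_poly -(dvdp_map iota) map_norm_poly //.
have gK0 : map_poly iota g != 0 by rewrite map_poly_eq0.
have N0 := monic_neq0 (conj_poly_monic n y).
apply/idP/idP => [dv|le_mup].
  by rewrite mup_geq // (dvdp_trans _ dv) // -mup_geq.
apply: (dvdp_mup N0 gK0) => x; rewrite {1}conj_poly_seq root_prod_XsubC.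
case/mapP => i _ ->; elim: i => [|i IH]; first by rewrite expr1.
rewrite -(frob_iter_point i y) (mup_frob iota _ g0).
by rewrite -{1}(map_frob_conj_poly yq) (mup_map_frob iota _ N0).
Qed.

(** If [y] has degree [delta], the norms of [y] are the powers of its minimal
    polynomial, taken over the extensions of degree a multiple of [delta]; as
    many of them divide [g] as the multiplicity of [y] says.  The bound
    [j < d] loses none, as the norm over the extension of degree [n] has
    degree [n]. *)
Lemma mup_count y (g : {poly F}) d delta : g != 0 -> size g = d.+1 ->
  (0 < delta)%N -> y ^+ (q ^ delta) = y ->
  (\sum_(j < d) (returns y j.+1 && (norm_poly j.+1 y %| g)%R))%N = mup y (map_poly iota g).
Proof.
move=> g0 sg_ delta0 yd; set e := mup _ _.
(* a range long enough for [y] to return [e] times *)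
pose D := (d + delta * e)%N.
have ret k : returns y (delta * k).
  rewrite /returns; elim: k => [|k IH]; first by rewrite muln0 expr1.
  by rewrite mulnS expnD exprM yd.
have : (\sum_(j < D) (returns y j.+1 && (norm_poly j.+1 y %| g)%R))%N = e.
  rewrite -[RHS](count_returns (A := returns y) (D := D)).
  - apply: eq_bigr => j _; congr nat_of_bool; case: (boolP (returns y j.+1)) => //= /eqP yq.
    by rewrite norm_poly_dvd.
  - by rewrite /returns expr1.
  rewrite {}/D; move: e => e.
  have : (e < \sum_(i < (delta * e).+1) returns y i)%N.
    elim: e => [|e IH]; first by rewrite muln0 big_ord1 /returns expr1 eqxx.
    rewrite big_ord_recr /= ret addn1 ltnS; apply: leq_trans IH _.
    rewrite -!(big_mkord xpredT (fun i => nat_of_bool (returns y i))).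
    rewrite [X in (_ <= X)%N](big_cat_nat (n := (delta * e).+1)) //=.
      exact: leq_addr.
    by rewrite mulnS -addn1 addnC leq_add2r.
  move/leq_trans; apply.
  rewrite -!(big_mkord xpredT (fun i => nat_of_bool (returns y i))).
  rewrite [X in (_ <= X)%N](big_cat_nat (n := (delta * e).+1)) //=; first exact: leq_addr.
  by rewrite ltnS leq_addl.
move=> <-; rewrite /D big_split_ord /= [X in (_ + X)%N]big1 ?addn0 // => j _.
apply/eqP; rewrite eqb0; apply/andP => -[/eqP yq /(dvdp_leq g0)].
by rewrite size_norm_poly // sg_ ltnS leqNgt ltnS leq_addr.
Qed.
End Norm.

(** * The L-function of a periodic multiplicative function *)

Lemma count_eq_uniq (T : eqType) (s s' : seq T) (P P' : pred T) :
  uniq s -> uniq s' -> (forall y, (y \in s) && P y = (y \in s') && P' y) ->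
  count P s = count P' s'.
Proof.
move=> u u' E; rewrite -!size_filter; apply/perm_size/uniq_perm; rewrite ?filter_uniq //.
by move=> y; rewrite !mem_filter andbC E andbC.
Qed.

Lemma sum_nat_of_bool (T : Type) (s : seq T) (P : pred T) :
  (\sum_(y <- s) P y)%N = count P s.
Proof. by rewrite -sum1_count [RHS]big_mkcond; apply: eq_bigr => y _; case: (P y). Qed.

Section LFunction.
Variables (F : finFieldType) (K : closedFieldType) (iota : {rmorphism F -> K}).
Local Notation q := #|F|.
Local Notation sg := (frob iota).

(** The orbit of [y] under Frobenius consists of roots of [g], so it is finite,
    and Frobenius is injective. *)
Lemma root_periodic (g : {poly F}) y : g != 0 -> root (map_poly iota g) y ->
  exists2 delta, (0 < delta)%N & y ^+ (q ^ delta) = y.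
Proof.
move=> g0 gy; have gK0 : map_poly iota g != 0 by rewrite map_poly_eq0.
pose s := mkseq (fun i => iter i sg y) (size (map_poly iota g)).
have [us|] := boolP (uniq s).
  have : (size s < size (map_poly iota g))%N.
    apply: max_poly_roots => //; apply/allP => _ /mapP[i _ ->].
    elim: i => //= i; rewrite /root => /eqP E.
    by rewrite -horner_frob E rmorph0.
  by rewrite size_mkseq ltnn.
case/(uniqPn 0) => i [j [ij]]; rewrite size_mkseq => js.
rewrite !nth_mkseq ?(ltn_trans ij js) // => E.
exists (j - i)%N; first by rewrite subn_gt0.
have inj : injective (iter i sg).
  by elim: i {ij E} => //= i IH; apply: inj_comp IH; exact: fmorph_inj.
by rewrite -(iter_frob iota); apply: inj; rewrite -iterD subnKC // ltnW.
Qed.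

(** By [mup_count] each root of [g] accounts for as many divisors as its
    multiplicity. *)
Lemma count_norm_divisors (g : {poly F}) d : g \is monic -> size g = d.+1 ->
  (\sum_(j < d) \sum_(y <- ext_points F K j.+1) (norm_poly iota j.+1 y %| g)%R)%N = d.
Proof.
move=> gm sz; have g0 := monic_neq0 gm.
have gK0 : map_poly iota g != 0 by rewrite map_poly_eq0.
pose rs := distinct_roots (map_poly iota g).
have urs : uniq rs by exact: undup_uniq.
have mrs y : (y \in rs) = root (map_poly iota g) y by exact: mem_distinct_roots.
transitivity (\sum_(j < d) \sum_(y <- rs) (returns F y j.+1 && (norm_poly iota j.+1 y %| g)%R))%N.
  apply: eq_bigr => j _; rewrite !sum_nat_of_bool; apply: count_eq_uniq => //.
    exact: uniq_ext_points.
  move=> y; rewrite mem_ext_points // -/(returns F y j.+1) andbA.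
  case: (boolP (returns _ _ _)) => /=.
    move=> /eqP yq; rewrite andbT; case: (boolP (norm_poly _ _ _ %| g)); rewrite ?andbF //.
    rewrite -(dvdp_map iota) map_norm_poly // andbT => dv; apply/esym; rewrite mrs.
    rewrite -dvdp_XsubCl (dvdp_trans _ dv) // dvdp_XsubCl /conj_poly big_ord_recl rootM.
    by rewrite expr1 root_XsubC eqxx.
  by rewrite andbF.
rewrite exchange_big /= -[RHS]/(d.+1.-1) -sz -(size_map_poly iota).
rewrite -(sum_mup gK0 urs) => [|x]; last by rewrite mrs.
rewrite big_seq [RHS]big_seq; apply: eq_bigr => y; rewrite mrs => /(root_periodic g0)[delta d0 yd].
exact: mup_count d0 yd.
Qed.

Variables (lam : {poly F} -> algC) (h g0 : {poly F}).
Hypothesis lamM : forall g g', lam (g * g') = lam g * lam g'.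
Hypothesis lam1 : lam 1 = 1.
Hypothesis lam_mod : forall g g', h %| g - g' -> lam g = lam g'.
Hypothesis h0 : h != 0.
Hypothesis g0h : coprimep g0 h.
Hypothesis lamg0 : lam g0 != 1.
Local Notation Z := (size h).-1.

Definition Lcoef d := \sum_(v : 'rV[F]_d) lam (monic_of v).
Definition Lsum n := \sum_(y <- ext_points F K n) lam (norm_poly iota n y).

Lemma Lcoef0 : Lcoef 0 = 1.
Proof.
rewrite /Lcoef (eq_bigr (fun => 1)) => [|v _].
  by rewrite sumr_const card_mx muln0 expn0.
by rewrite /monic_of thinmx0 linear0 addr0 expr0.
Qed.

(** The coefficient form of [T L' / L = \sum_n Lsum n T ^ n]: by
    [count_norm_divisors], [d] counts the pairs of a degree [j.+1] and a point
    [y] whose norm divides a given monic polynomial of degree [d]; summing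
    first over the cofactors gives the right-hand side.  This replaces the
    Euler product. *)
Lemma L_newton d : d%:R * Lcoef d = \sum_(j < d) Lsum j.+1 * Lcoef (d - j.+1).
Proof.
transitivity (\sum_(v : 'rV[F]_d) \sum_(j < d) \sum_(y <- ext_points F K j.+1)
     (norm_poly iota j.+1 y %| monic_of v)%R%:R * lam (monic_of v)).
  rewrite mulr_sumr; apply: eq_bigr => v _.
  rewrite -{1}(count_norm_divisors (monic_of_monic v) (size_monic_of v)).
  rewrite natr_sum mulr_suml; apply: eq_bigr => j _.
  by rewrite natr_sum mulr_suml.
rewrite exchange_big; apply: eq_bigr => j _; rewrite exchange_big mulr_suml /=.
rewrite big_seq [RHS]big_seq; apply: eq_bigr => y; rewrite mem_ext_points // => /eqP yq.
have -> : lam (norm_poly iota j.+1 y) * Lcoef (d - j.+1)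
    = \sum_(u : 'rV[F]_(d - j.+1)) lam (norm_poly iota j.+1 y * monic_of u).
  by rewrite mulr_sumr; apply: eq_bigr => u _; rewrite lamM.
rewrite -(sum_monic_multiples lam (norm_poly_monic iota yq) (size_norm_poly iota yq)) //.
rewrite [RHS]big_mkcond.
by apply: eq_bigr => v _; case: ifP; rewrite ?mul1r ?mul0r.
Qed.

(** [Lcoef d] is zero from the degree of [h] on, so the L-function is a
    polynomial; the [w] in [s] are its inverse roots, and [L_newton] identifies
    the [Lsum n] with their power sums. *)
Theorem L_power_sums : exists s : seq algC, (size s <= Z.-1)%N /\
  forall n, (0 < n)%N -> Lsum n = - psum s n.
Proof.
pose A := \poly_(d < Z) Lcoef d.
have AE d : A`_d = Lcoef d.
  rewrite coef_poly; case: ltnP => // Zd; apply/esym.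
  exact: (monic_sum0 lamM lam_mod h0 g0h lamg0 Zd).
have [|s [sz Es]] := @poly_inv_roots algC A; first by rewrite AE Lcoef0.
exists s; split.
  have sA : (size A <= Z)%N by exact: size_poly.
  apply: leq_trans sz _; move: sA; case: (size A) => [|a] //= aZ.
  by rewrite -ltnS (leq_trans aZ) // leqSpred.
apply: (newton_unique (c := Lcoef) (Z := Z)).
- exact: Lcoef0.
- by move=> d Zd; exact: (monic_sum0 lamM lam_mod h0 g0h lamg0 Zd).
- by move=> d; rewrite -Es AE.
- exact: L_newton.
Qed.
End LFunction.

(** * The Weil bound *)

Lemma bernoulli_ineq (a : algC) n : 0 <= a -> 1 + n%:R * a <= (1 + a) ^+ n.
Proof.
move=> a0; elim: n => [|n IH]; first by rewrite mul0r addr0 expr0.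
have a1 : 0 <= 1 + a by rewrite addr_ge0.
rewrite exprS; apply: le_trans (ler_wpM2l a1 IH).
rewrite mulrDr mulr1 mulrDl mul1r -natr1 mulrDl mul1r [n%:R * a + a]addrC !addrA.
by rewrite lerDl mulr_ge0 // mulr_ge0.
Qed.

Lemma powers_bounded (u c : algC) :
  0 <= u -> (forall n, (0 < n)%N -> u ^+ n <= c) -> u <= 1.
Proof.
move=> u0 Hc; rewrite real_leNgt ?ger0_real //; apply/negP => u1.
pose a := u - 1; have a0 : 0 < a by rewrite subr_gt0.
have c0 : 0 <= c by apply: le_trans (Hc 1%N isT); rewrite expr1.
have ca : 0 <= c / a by rewrite divr_ge0 // ltW.
pose n := (Num.bound (c / a)).+1.
have : c < n%:R * a.
  rewrite -ltr_pdivrMr //; apply: lt_le_trans (archi_boundP ca) _.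
  by rewrite ler_nat leqnSn.
apply/negP; rewrite -real_leNgt ?ger0_real //; last by rewrite mulr_ge0 // ltW.
apply: le_trans (Hc n isT); have -> : u = 1 + a by rewrite addrC subrK.
by apply: le_trans (bernoulli_ineq n (ltW a0)); rewrite lerDr ler01.
Qed.

(** A fixed linear combination of [psum s n], [psum s n.+1], ..., with the
    coefficients of a polynomial vanishing at all elements of [s] but [w],
    isolates a nonzero multiple of [w ^+ n]; so the powers of [`|w| / B] are
    bounded. *)
Lemma psum_bound_roots (s : seq algC) (c B : algC) : 0 < B ->
  (forall n, (0 < n)%N -> `|psum s n| <= c * B ^+ n) ->
  forall w, w \in s -> `|w| <= B.
Proof.
move=> B0 Hs w ws.
pose Q : {poly algC} := \prod_(x <- [seq x <- s | x != w]) ('X - x%:P).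
have Qw : Q.[w] != 0.
  by rewrite -/(root _ _) root_prod_XsubC mem_filter eqxx.
have Qx x : x \in s -> x != w -> Q.[x] = 0.
  by move=> xs xw; apply/eqP; rewrite -/(root _ _) root_prod_XsubC mem_filter xw.
have E n : \sum_(k < size Q) Q`_k * psum s (n + k) = (w ^+ n * Q.[w]) *+ count_mem w s.
  transitivity (\sum_(x <- s) x ^+ n * Q.[x]).
    under eq_bigr do rewrite mulr_sumr.
    rewrite exchange_big; apply: eq_bigr => x _; rewrite horner_coef mulr_sumr.
    by apply: eq_bigr => k _; rewrite mulrCA exprD.
  rewrite -sumr_const_seq [RHS]big_mkcond [LHS]big_seq [RHS]big_seq.
  apply: eq_bigr => x xs /=; case: eqP => [->//|/eqP xw].
  by rewrite Qx // mulr0.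
pose c' := (\sum_(k < size Q) `|Q`_k| * (c * B ^+ k)) / `|Q.[w]|.
suff : `|w| / B <= 1 by rewrite ler_pdivrMr // mul1r.
apply: (@powers_bounded _ c'); first by rewrite divr_ge0 // ltW.
move=> n n0; rewrite expr_div_n ler_pdivrMr ?exprn_gt0 // /c' mulrAC.
rewrite ler_pdivlMr ?normr_gt0 // -normrX -normrM.
have cw : (0 < count_mem w s)%N by rewrite -has_count has_pred1.
apply: le_trans (_ : `|(w ^+ n * Q.[w]) *+ count_mem w s| <= _).
  by rewrite normrMn -[X in X <= _]mulr1n ler_wpMn2l.
rewrite -E; apply: le_trans (ler_norm_sum _ _ _) _.
rewrite mulr_suml; apply: ler_sum => k _.
rewrite normrM -mulrA ler_wpM2l // -mulrA -exprD addnC; apply: Hs.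
by rewrite addn_gt0 n0 orbT.
Qed.

Section Weil.
Variables (F : finFieldType) (theta : {unit F}).
Hypothesis gen : generator [set: {unit F}] theta.
Variables (K : closedFieldType) (iota : {rmorphism F -> K}).
Variables (L : nat) (zeta : algC).
Hypothesis Lq : (L %| #|F|.-1)%N.
Hypothesis zP : L.-primitive_root zeta.
Variables (f : {poly F}) (rs : seq K).
Hypothesis f0 : f != 0.
Hypothesis urs : uniq rs.
Hypothesis srs : {in rs, forall x, frob iota x \in rs}.
Local Notation fK := (map_poly iota f).
Hypothesis hrs : forall x, root fK x -> x \in rs.
Hypothesis nL : exists rho, ~~ (L %| mup rho fK)%N.
Local Notation q := #|F|.
Local Notation sg := (frob iota).
Local Notation ch := (chi theta zeta).

Let m x := mup x fK.
Let mfrob x : m (sg x) = m x. Proof. exact: mup_frob. Qed.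

(** [W g] is, up to sign and the leading coefficient of [f], the resultant of
   [g] and [f]: a product of values of [g] at the roots of [f], or of values of
   [f] at the roots of [g].  The first form makes [lam] multiplicative and
   periodic, the second, in [lam_norm], turns [Lsum lam] into a character sum
   over an extension. *)
Let W (g : {poly F}) := \prod_(x <- rs) (map_poly iota g).[x] ^+ m x.
Let coprime_rs (g : {poly F}) := all (fun x => (map_poly iota g).[x] != 0) rs.
Let lam (g : {poly F}) : algC := if coprime_rs g then ch (descend iota (W g)) else 0.

Let W_fixed g : sg (W g) = W g. Proof. exact: (frob_prod_horner urs srs mfrob). Qed.

Let lamM g g' : lam (g * g') = lam g * lam g'.
Proof.
rewrite /lam; have -> : coprime_rs (g * g') = coprime_rs g && coprime_rs g'.
  rewrite /coprime_rs -all_predI; apply: eq_all => x /=.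
  by rewrite rmorphM hornerM mulf_eq0 negb_or.
case: (coprime_rs g); case: (coprime_rs g'); rewrite ?mul0r ?mulr0 //=.
rewrite -(chiM gen Lq zP) -descendM //; congr (ch (descend _ _)).
by rewrite /W -big_split; apply: eq_bigr => x _; rewrite rmorphM hornerM exprMn.
Qed.

Let lam1 : lam 1 = 1.
Proof.
have -> : lam 1 = ch (descend iota (W 1)).
  by rewrite /lam ifT //; apply/allP => x _; rewrite rmorph1 hornerC oner_eq0.
rewrite /W big1 ?descend1 ?(chi1 gen Lq zP) // => x _.
by rewrite rmorph1 hornerC expr1n.
Qed.

Let h_ex : exists h : {poly F}, map_poly iota h = \prod_(x <- rs) ('X - x%:P).
Proof.
have [h Eh] := descent_prod urs srs (m := fun=> 1%N) (fun=> erefl).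
by exists h; rewrite Eh.
Qed.

Let kap : F := (-1) ^+ (\sum_(x <- rs) m x) / lead_coef f.

Let kap_neq0 : kap != 0.
Proof. by rewrite mulf_neq0 ?invr_eq0 ?lead_coef_eq0 // expf_neq0 // oppr_eq0 oner_eq0. Qed.

Let W_point z : \prod_(x <- rs) (x - z) ^+ m x = iota kap * fK.[z].
Proof.
have fK0 : fK != 0 by rewrite map_poly_eq0.
rewrite {1}(closed_factor fK0 urs hrs) lead_coef_map hornerZ horner_prod.
rewrite /kap rmorphM fmorphV /= mulrA divfK ?fmorph_eq0 ?lead_coef_eq0 //.
rewrite rmorphXn rmorphN rmorph1 -prodrXr -big_split; apply: eq_bigr => x _ /=.
by rewrite horner_exp hornerXsubC -exprMn mulN1r opprB.
Qed.

Let fK_expq z i : fK.[z ^+ (q ^ i)] = fK.[z] ^+ (q ^ i).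
Proof. by rewrite -!(iter_frob iota); elim: i => //= i <-; rewrite horner_frob. Qed.

Let lam_norm n y : (0 < n)%N -> y \in ext_points F K n ->
  lam (norm_poly iota n y) =
    if y \in rs then 0 else ch kap ^+ n * ch (descend iota (fK.[y] ^+ norm_exp F n)).
Proof.
move=> n0; rewrite mem_ext_points // => /eqP yq.
have hE x : (map_poly iota (norm_poly iota n y)).[x] = \prod_(i < n) (x - y ^+ (q ^ i)).
  by rewrite map_norm_poly // horner_prod; apply: eq_bigr => i _; rewrite hornerXsubC.
have -> : lam (norm_poly iota n y) =
    if y \in rs then 0 else ch (descend iota (W (norm_poly iota n y))).
  rewrite /lam; have -> : coprime_rs (norm_poly iota n y) = (y \notin rs).
    apply/allP/idP => [Hc|yr x xr]; last first.
      rewrite hE; apply/prodf_neq0 => i _; rewrite subr_eq0.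
      by apply: contraNneq yr => Ex; rewrite -(mem_frobX urs srs i) -Ex.
    apply/negP => /Hc; rewrite hE (bigD1 (Ordinal n0)) //= expr1 subrr mul0r.
    by rewrite eqxx.
  by case: (y \in rs).
case: ifP => // _; rewrite -(chiX gen Lq zP) -(chiM gen Lq zP); congr ch.
apply: (fmorph_inj iota); rewrite descendK // rmorphM rmorphXn /= descendK; last first.
  by apply: frob_norm => //; rewrite -fK_expq yq.
rewrite /W; under eq_bigr do rewrite hE -prodrXl.
rewrite exchange_big /=; under eq_bigr do rewrite W_point fK_expq.
rewrite big_split /= prodr_const card_ord; congr (_ * _).
by rewrite /norm_exp expr_sum.
Qed.

(** The L-function of [lam] gives [S_n = - \sum_w w ^+ n] with at most
    [(size rs).-1] numbers [w], where [S_n] is, up to a factor of modulus [1],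
    the character sum over the extension of degree [n].  By
    [charsum_even_bound] the power sums of the squares [w ^+ 2] are
    [O(q ^ n)], so that [`|w|] is at most the square root of [q]. *)
Theorem weil_bound :
  `|\sum_(x : F | iota x \notin rs) ch f.[x]| <= (size rs).-1%:R * sqrtC q%:R.
Proof.
have [h Eh] := h_ex.
have h0 : h != 0.
  by rewrite -(map_poly_eq0 iota) Eh monic_neq0 // monic_prod_XsubC.
have sh : size h = (size rs).+1 by rewrite -(size_map_poly iota) Eh size_prod_XsubC.
have hroot g x : x \in rs -> h %| g -> (map_poly iota g).[x] = 0.
  move=> xr; rewrite -(dvdp_map iota) => dv; apply/eqP; rewrite -/(root _ _) -dvdp_XsubCl.
  by apply: dvdp_trans dv; rewrite dvdp_XsubCl Eh root_prod_XsubC.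
have lam_mod g g' : h %| g - g' -> lam g = lam g'.
  move=> dv; have E : {in rs, forall x, (map_poly iota g).[x] = (map_poly iota g').[x]}.
    move=> x xr; apply/eqP; rewrite -subr_eq0 -hornerN -hornerD -rmorphB.
    by apply/eqP/hroot.
  have EW : W g = W g'.
    by rewrite /W big_seq [RHS]big_seq; apply: eq_bigr => x xr; rewrite E.
  have Ec : coprime_rs g = coprime_rs g'.
    by apply: eq_in_all => x xr; rewrite E.
  by rewrite /lam Ec EW.
have [C HC] := charsum_even_bound gen Lq zP f0 urs srs hrs nL.
have LsumE n : (0 < n)%N -> Lsum iota lam n =
    ch kap ^+ n * \sum_(y <- ext_points F K n | y \notin rs)
                    ch (descend iota (fK.[y] ^+ norm_exp F n)).
  move=> n0; rewrite /Lsum mulr_sumr [RHS]big_mkcond big_seq [RHS]big_seq.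
  by apply: eq_bigr => y yF; rewrite lam_norm //; case: (y \in rs).
have nkap : `|ch kap| = 1 by rewrite (norm_chi theta zP).
have q0 : 0 < q%:R :> algC by rewrite ltr0n ltnW // card_finField_gt1.
have bnd n : (0 < n)%N -> `|Lsum iota lam (2 * n)| <= C%:R * q%:R ^+ n.
  move=> n0; rewrite LsumE ?muln_gt0 // normrM normrX nkap expr1n mul1r.
  by apply: le_trans (HC n n0) _; rewrite natrM natrX.
(* If [lam] were [1] at all norms prime to [h], then [Lsum lam (2 * n)] would be
   at least [q ^ (2 * n) - size rs], which for large [n] contradicts [bnd]. *)
have [g0 g0h lg0] : exists2 g0, coprimep g0 h & lam g0 != 1.
  pose n := (C + size rs).+1.
  have n2 : (0 < 2 * n)%N by rewrite muln_gt0.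
  have [/hasP[y]|/hasPn all1] := boolP (has (fun y => lam (norm_poly iota (2 * n) y) != 1)
      [seq y <- ext_points F K (2 * n) | y \notin rs]).
    rewrite mem_filter mem_ext_points // => /andP[yr /eqP yq] ly.
    exists (norm_poly iota (2 * n) y) => //.
    rewrite -(coprimep_map iota) Eh map_norm_poly //.
    rewrite big_seq; apply: (big_ind (fun p => coprimep _ p)).
    - exact: coprimep1.
    - by move=> p r cp cr; rewrite coprimepMr cp.
    move=> x xr; rewrite coprimep_XsubC /root horner_prod; apply/prodf_neq0 => i _.
    rewrite hornerXsubC subr_eq0; apply: contraNneq yr => Ex.
    by rewrite -(mem_frobX urs srs i) -Ex.
  have := bnd n isT.
  have -> : Lsum iota lam (2 * n) = (count (fun y => y \notin rs) (ext_points F K (2 * n)))%:R.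
    rewrite -sumr_const_seq [RHS]big_mkcond [LHS]big_seq [RHS]big_seq.
    apply: eq_bigr => y yF; case: (boolP (y \in rs)) => yr; first by rewrite lam_norm // yr.
    by apply/eqP/negPn/all1; rewrite mem_filter yr.
  rewrite normr_nat -natrX -natrM ler_nat.
  have : (count (fun y => y \in rs) (ext_points F K (2 * n)) <= size rs)%N.
    rewrite -size_filter; apply: uniq_leq_size; first by rewrite filter_uniq // uniq_ext_points.
    by move=> y; rewrite mem_filter => /andP[].
  have := count_predC (fun y => y \in rs) (ext_points F K (2 * n)).
  rewrite (size_ext_points iota) // mulnC expnM -mulnn.
  have : (C + size rs < q ^ n)%N by apply: ltn_trans (ltn_expl _ (card_finField_gt1 F)).
  set a := count _ _; set b := count (predC _) _; move: (q ^ n)%N => Q.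
  rewrite -/b => H1 H2 H3 H4; exfalso; nia.
have [s [sz Hs]] := L_power_sums iota lamM lam1 lam_mod h0 g0h lg0.
rewrite sh /= in sz.
have ws w : w \in s -> `|w| <= sqrtC q%:R.
  move=> wS; rewrite -(@ler_pXn2r _ 2) ?nnegrE ?sqrtC_ge0 ?ler0n // sqrtCK -normrX.
  apply: (@psum_bound_roots [seq w ^+ 2 | w <- s] C%:R) => //; last exact: map_f.
  move=> n n0; have -> : psum [seq w ^+ 2 | w <- s] n = psum s (2 * n).
    by rewrite /psum big_map; apply: eq_bigr => x _; rewrite -exprM.
  by rewrite -normrN -Hs ?muln_gt0 // bnd.
have -> : `|\sum_(x : F | iota x \notin rs) ch f.[x]| = `|Lsum iota lam 1|.
  rewrite LsumE // normrM normrX nkap expr1n mul1r; congr `|_|.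
  have pF : perm_eq (ext_points F K 1) (map iota (enum F)).
    apply: uniq_perm; rewrite ?uniq_ext_points //.
      by rewrite map_inj_uniq ?enum_uniq //; exact: fmorph_inj.
    move=> y; rewrite mem_ext_points // expn1; apply/eqP/mapP => [yq|[x _ ->]].
      by have [x Ex] := @frob_fixedP _ _ iota y yq; exists x; rewrite ?mem_enum.
    by rewrite -(frobE iota) frob_iota.
  rewrite (perm_big _ pF) big_map big_enum_cond /=; apply: eq_big => // x _.
  by rewrite horner_map /norm_exp big_ord1 !expr1 iotaK.
rewrite Hs // normrN /psum; apply: le_trans (ler_norm_sum _ _ _) _.
apply: le_trans (_ : (size s)%:R * sqrtC q%:R <= _); last first.
  by rewrite ler_wpM2r ?sqrtC_ge0 ?ler0n // ler_nat.
rewrite mulr_natl -[X in _ *+ X]count_predT -sumr_const_seq.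
rewrite big_seq [X in _ <= X]big_seq; apply: ler_sum => w wS.
by rewrite expr1 ws.
Qed.
End Weil.

(** * Counting points with prescribed logarithms *)

Lemma sum_unity_orthogonality (d : nat) (xi : algC) n : d.-primitive_root xi ->
  \sum_(j < d) xi ^+ (j * n) = (if (d %| n)%N then d else 0%N)%:R.
Proof.
move=> xP; under eq_bigr do rewrite mulnC exprM.
case: ifP => dn.
  have -> : xi ^+ n = 1 by apply/eqP; rewrite -(prim_order_dvd xP).
  by under eq_bigr do rewrite expr1n; rewrite sumr_const card_ord.
apply: (mulfI (x := xi ^+ n - 1)).
  by rewrite subr_eq0 -(prim_order_dvd xP) dn.
by rewrite -subrX1 mulr0 exprAC (prim_expr_order xP) expr1n subrr.
Qed.

Lemma residue_dvdn d a x : (a <= d)%N -> (d %| x + (d - a))%N = (x == a %[mod d]).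
Proof. by move=> ad; rewrite -(eqn_modDr (d - a)) subnKC // modnn. Qed.

Section Count.
Variables (F : finFieldType) (theta : {unit F}).
Hypothesis gen : generator [set: {unit F}] theta.
Variables (K : closedFieldType) (iota : {rmorphism F -> K}).
Variables (k : nat) (d a : 'I_k -> nat) (P : 'I_k -> {poly F}).
Hypothesis k0 : (0 < k)%N.
Hypothesis d1 : forall i, (1 < d i)%N.
Hypothesis dq : forall i, (d i %| #|F|.-1)%N.
Hypothesis ad : in_Lambda d a.
Hypothesis P0 : forall i, P i != 0.
Hypothesis indep : mult_indep d P.
Local Notation q := #|F|.
Local Notation Z := (Zcount iota P).

Let L := \big[lcmn/1%N]_(i < k) d i.
Let D := (\prod_(i < k) d i)%N.
Let rs := distinct_roots (map_poly iota (\prod_(i < k) P i)).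

Let dL i : (d i %| L)%N. Proof. exact: (dvdn_biglcmP _ _ _ (dvdnn L)). Qed.
Let Lq : (L %| q.-1)%N. Proof. by apply/dvdn_biglcmP => i _. Qed.
Let L0 : (0 < L)%N.
Proof. by apply: dvdn_gt0 Lq; rewrite -subn1 subn_gt0 card_finField_gt1. Qed.

Let urs : uniq rs. Proof. exact: undup_uniq. Qed.

Let prod0 : \prod_(i < k) P i != 0. Proof. by apply/prodf_neq0 => i _. Qed.

Let mrs x : (x \in rs) = [exists i, root (map_poly iota (P i)) x].
Proof.
rewrite mem_distinct_roots ?map_poly_eq0 // rmorph_prod /root horner_prod.
apply/eqP/existsP => [/eqP|[i /eqP Ei]]; last by rewrite (bigD1 i) //= Ei mul0r.
by case/prodf_eq0 => i _ Ei; exists i.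
Qed.

Let srs : {in rs, forall x, frob iota x \in rs}.
Proof.
move=> x; rewrite !mrs => /existsP[i /eqP Ei]; apply/existsP; exists i.
by rewrite /root -horner_frob Ei rmorph0.
Qed.

Let fpoly (j : 'I_k -> nat) := \prod_(i < k) P i ^+ (L %/ d i * j i).

Let fpoly0 j : fpoly j != 0.
Proof. by apply/prodf_neq0 => i _; rewrite expf_neq0. Qed.

Let fpoly_roots j x : root (map_poly iota (fpoly j)) x -> x \in rs.
Proof.
rewrite mrs rmorph_prod /root horner_prod => /prodf_eq0[i _].
by rewrite rmorphXn horner_exp expf_eq0 => /andP[_ Ei]; apply/existsP; exists i.
Qed.

(** If all multiplicities were divisible by [L], descent would write [fpoly j]
    as a constant times the [L]-th power of a monic polynomial over [F], and
    [mult_indep] would force [j] to be zero. *)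
Let fpoly_nonpower j : (forall i, j i < d i)%N -> ~ (forall i, j i = 0%N) ->
  exists rho, ~~ (L %| mup rho (map_poly iota (fpoly j)))%N.
Proof.
move=> jd jn0; set f := fpoly j.
have fK0 : map_poly iota f != 0 by rewrite map_poly_eq0 fpoly0.
have [/hasP[rho _ H]|/hasPn all1] :=
  boolP (has (fun rho => ~~ (L %| mup rho (map_poly iota f))%N) rs); first by exists rho.
case: jn0; have mfrob x : (mup (frob iota x) (map_poly iota f) %/ L
    = mup x (map_poly iota f) %/ L)%N by rewrite mup_frob ?fpoly0.
have [G EG] := descent_prod urs srs mfrob.
have Gm : G \is monic.
  rewrite -(map_monic iota) EG; apply: monic_prod => x _.
  by rewrite monic_exp // monicXsubC.
suff Ef : f = lead_coef f *: G ^+ L.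
  have lf0 : lead_coef f != 0 by rewrite lead_coef_eq0 fpoly0.
  by have [] := indep jd lf0 Gm Ef.
apply: (map_poly_inj iota); rewrite map_polyZ rmorphXn /= -lead_coef_map EG -prodrXl.
rewrite {1}(closed_factor fK0 urs (@fpoly_roots j)); congr (_ *: _).
rewrite big_seq [RHS]big_seq; apply: eq_bigr => x xr; rewrite -exprM divnK //.
by have := all1 x xr; rewrite negbK.
Qed.

(** As [k > 0] and [d i > 1], the constant tuple [1] is a nonzero element of
    [Lambda(d)], so the corresponding product has a root. *)
Lemma Zcount_gt0 : (0 < Z)%N.
Proof.
have [rho] : exists rho, ~~ (L %| mup rho (map_poly iota (fpoly (fun=> 1%N))))%N.
  by apply: fpoly_nonpower => // /(_ (Ordinal k0)).
rewrite /Zcount -/rs; case: posnP => // /size0nil rs0 /negP[].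
rewrite mupNroot ?dvdn0 //; apply/negP => /fpoly_roots.
by rewrite rs0.
Qed.

Lemma prod_d_gt1 : (1 < D)%N.
Proof.
rewrite /D (bigD1 (Ordinal k0)) //=; apply: leq_trans (d1 (Ordinal k0)) _.
by apply: leq_pmulr; rewrite prodn_gt0 // => i; apply: ltnW.
Qed.

(** Each condition on a logarithm is detected by a sum over [d i]-th roots of
    unity; expanding the product of these sums yields one character sum for
    each tuple [f] with [f i < d i].  The zero tuple [f0] counts the points
    where no [P i] vanishes, and [weil_bound] handles the others. *)
Lemma count_estimate :
  `|(Ncount theta d a P * D)%N%:R - q%:R| <= Z%:R + (D.-1 * Z.-1)%N%:R * sqrtC q%:R :> algC.
Proof.
have [zeta zP] := C_prim_root_exists L0.
pose xi i := zeta ^+ (L %/ d i).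
have xiP i : (d i).-primitive_root (xi i).
  by rewrite /xi; apply: dvdn_prim_root.
pose ok (y : F) := iota y \notin rs.
have okE y : ok y = [forall i, (P i).[y] != 0].
  rewrite /ok mrs negb_exists; apply: eq_forallb => i.
  by rewrite /root horner_map fmorph_eq0.
(* The exponents [t < d i] are embedded in the common type ['I_q]. *)
pose Q (i : 'I_k) := [pred t : 'I_q | (t < d i)%N].
have dleq i : (d i <= q)%N.
  apply: leq_trans (dvdn_leq _ (dq i)) (leq_pred _).
  by rewrite -subn1 subn_gt0 card_finField_gt1.
have cardQ : #|family Q| = D.
  rewrite card_family foldrE big_map big_enum /=; apply: eq_bigr => i _.
  rewrite -sum1_card -(big_ord_widen _ (fun=> 1%N)) // sum1_card card_ord //.
pose c (f : {ffun 'I_k -> 'I_q}) := \prod_i xi i ^+ (f i * (d i - a i)).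
have nxi i : `|xi i| = 1.
  apply/eqP; rewrite -(@pexpr_eq1 _ _ (d i)) ?(ltnW (d1 i)) // -?normrX.
  by rewrite (prim_expr_order (xiP i)) normr1.
have nc f : `|c f| = 1.
  by rewrite /c normr_prod big1 // => i _; rewrite normrX nxi expr1n.
pose S (f : {ffun 'I_k -> 'I_q}) :=
  \sum_(y : F | ok y) chi theta zeta (fpoly (fun i => f i)).[y].
have distr (G : 'I_k -> nat -> algC) :
    \prod_(i < k) \sum_(t < d i) G i t = \sum_(f in family Q) \prod_(i < k) G i (f i).
  rewrite -(bigA_distr_big_dep (fun i => Q i) (fun i (t : 'I_q) => G i t)).
  by apply: eq_bigr => i _; rewrite (big_ord_widen q (G i) (dleq i)).
have step1 : (Ncount theta d a P * D)%N%:R = \sum_(f in family Q) c f * S f.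
  transitivity (\sum_(y | ok y) \prod_(i < k)
      (\sum_(t < d i) xi i ^+ (t * (dlog theta (P i).[y] + (d i - a i)))) : algC).
    rewrite natrM /Ncount -sum1_card natr_sum mulr_suml.
    rewrite big_mkcond [RHS]big_mkcond; apply: eq_bigr => y _; rewrite inE mul1r okE.
    case: (boolP [forall i, (P i).[y] != 0]) => [/forallP Py|/forallPn[i]]; last first.
      by rewrite negbK => Pi; case: ifP => // /forallP/(_ i); rewrite Pi.
    under eq_bigr do rewrite (sum_unity_orthogonality _ (xiP _)) residue_dvdn ?(ltnW (ad _)) //.
    case: ifP => [/forallP H|/negbT/forallPn[i]].
      rewrite /D natr_prod; apply: eq_bigr => i _.
      by have := H i; rewrite Py /= => ->.
    by rewrite Py /= => /negPf H; rewrite (bigD1 i) //= H mul0r.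
  rewrite (eq_bigr _ (fun y _ => distr (fun i t =>
    xi i ^+ (t * (dlog theta (P i).[y] + (d i - a i)))))).
  rewrite exchange_big; apply: eq_bigr => f _; rewrite mulr_sumr /=.
  apply: eq_bigr => y; rewrite okE => /forallP Py.
  have -> : chi theta zeta (fpoly (fun i => f i)).[y] =
      \prod_(i < k) xi i ^+ (f i * dlog theta (P i).[y]).
    rewrite /fpoly horner_prod (big_morph _ (chiM gen Lq zP) (chi1 gen Lq zP)).
    apply: eq_bigr => i _; rewrite horner_exp (chiX gen Lq zP) /chi (negPf (Py i)).
    by rewrite -!exprM; congr (_ ^+ _); rewrite mulnC mulnA.
  rewrite /c -big_split /=; apply: eq_bigr => i _.
  by rewrite -exprD -mulnDr addnC.
have q0 : (0 < q)%N by apply: ltnW (card_finField_gt1 F).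
pose f0 : {ffun 'I_k -> 'I_q} := [ffun=> Ordinal q0].
have f0Q : f0 \in family Q by apply/familyP => i; rewrite ffunE inE /= ltnW.
have Sf f : f \in family Q -> f != f0 -> `|c f * S f| <= Z.-1%:R * sqrtC q%:R.
  move=> /familyP fQ ff0; rewrite normrM nc mul1r.
  apply: (weil_bound gen Lq zP (fpoly0 _) urs srs (@fpoly_roots _)).
  apply: fpoly_nonpower => [i|H]; first by have := fQ i; rewrite inE.
  by case/eqP: ff0; apply/ffunP => i; rewrite ffunE; apply: val_inj; rewrite /= H.
have Sf0 : `|c f0 * S f0 - q%:R| <= Z%:R.
  have -> : c f0 = 1 by rewrite /c big1 // => i _; rewrite ffunE mul0n expr0.
  have -> : S f0 = #|[pred y | ok y]|%:R.
    rewrite /S -[in RHS]sum1_card natr_sum; apply: eq_bigr => y _.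
    rewrite /fpoly big1 ?hornerC ?(chi1 gen Lq zP) // => i _.
    by rewrite ffunE muln0 expr0.
  have <- := cardC [pred y | ok y].
  rewrite mul1r natrD opprD addrA subrr sub0r normrN normr_nat ler_nat.
  rewrite /Zcount -/rs cardE -(size_map iota); apply: uniq_leq_size.
    by rewrite map_inj_uniq ?enum_uniq //; exact: fmorph_inj.
  by move=> _ /mapP[y yin ->]; move: yin; rewrite mem_enum inE negbK.
rewrite step1 (bigD1 f0) //= addrAC.
apply: le_trans (ler_normD _ _) _; apply: lerD => //.
apply: le_trans (ler_norm_sum _ _ _) _.
apply: le_trans (ler_sum _ (G := fun=> Z.-1%:R * sqrtC q%:R) _) _.
  by move=> f /andP[]; exact: Sf.
have -> : \sum_(i in family Q | i != f0) Z.-1%:R * sqrtC q%:R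
    = (Z.-1%:R * sqrtC q%:R) *+ D.-1 :> algC.
  rewrite sumr_const; congr (_ *+ _).
  have := cardD1 f0 (family Q); rewrite f0Q cardQ add1n => ->.
  by rewrite -pred_Sn; apply: eq_card => f; rewrite !inE andbC.
by rewrite natrM -mulrA [X in _ <= X]mulr_natl lexx.
Qed.
End Count.

(** Since [D > 1], the sum [Z + (D - 1) (Z - 1) sqrt q] is less than
    [D Z sqrt q].  Squaring gives an inequality between integers, which can be
    read in any ordered field. *)
Lemma strict_int_estimate (x : int) (Z D q : nat) :
  (0 < Z)%N -> (1 < D)%N -> (1 < q)%N ->
  `|x%:~R| <= Z%:R + (D.-1 * Z.-1)%N%:R * sqrtC q%:R :> algC ->
  x ^+ 2 < ((D * Z) ^ 2 * q)%N%:Z.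
Proof.
move=> Z0 D1 q1 le_x; pose s := sqrtC q%:R : algC.
have s1 : 1 <= s by rewrite -[X in X <= _]sqrtC1 ler_sqrtC ?nnegrE ?ler01 ?ler0n // ler1n ltnW.
have s0 : 0 < s by apply: lt_le_trans s1.
have lt_x : `|x%:~R| < (D * Z)%:R * s :> algC.
  apply: le_lt_trans le_x _; rewrite -/s.
  apply: le_lt_trans (_ : (Z + D.-1 * Z.-1)%:R * s < _).
    by rewrite natrD mulrDl lerD2r ler_peMr // ler0n.
  rewrite ltr_pM2r // ltr_nat.
  rewrite -[in X in (_ < X)%N](prednK (ltnW D1)) mulSn ltn_add2l ltn_pmul2l; last first.
    by rewrite -subn1 subn_gt0.
  by rewrite ltn_predL.
rewrite -(ltr_int algC) rmorphXn /= -real_normK ?realz // -pmulrn.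
rewrite natrM natrX -[q%:R](sqrtCK (q%:R : algC)) -exprMn -/s.
by rewrite ltrXn2r.
Qed.

Theorem theorem2p3 (R : rcfType) (F : finFieldType) (theta : {unit F})
    (htheta : generator [set: {unit F}] theta)
    (K : closedFieldType) (iota : {rmorphism F -> K})
    (hK : is_alg_closure iota)
    (k : nat) (hk : (1 <= k)%N)
    (d : 'I_k -> nat) (hd1 : forall i, (1 < d i)%N)
    (hd : forall i, (d i %| #|F|.-1)%N)
    (a : 'I_k -> nat) (ha : in_Lambda d a)
    (P : 'I_k -> {poly F}) (hP0 : forall i, P i != 0)
    (hP : mult_indep d P) :
  (exists H : R,
      (Ncount theta d a P)%:R = #|F|%:R / (\prod_(i < k) d i)%N%:R + H
      /\ `|H| < (Zcount iota P)%:R * Num.sqrt #|F|%:R)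
  /\ ((Zcount iota P)%:R <= Num.sqrt #|F|%:R / (\prod_(i < k) d i)%N%:R :> R ->
      (0 < Ncount theta d a P)%N).
Proof.
set N := Ncount theta d a P; set Z := Zcount iota P; set D := (\prod_(i < k) d i)%N.
have D1 : (1 < D)%N := prod_d_gt1 hk hd1.
have D0 : 0 < D%:R :> R by rewrite ltr0n ltnW.
have s0 : 0 < Num.sqrt #|F|%:R :> R by rewrite sqrtr_gt0 ltr0n ltnW // card_finField_gt1.
have bound : `|N%:R - #|F|%:R / D%:R| < Z%:R * Num.sqrt #|F|%:R :> R.
  have Z0 : (0 < Z)%N := Zcount_gt0 iota hk hd1 hP0 hP.
  have := count_estimate htheta iota hd1 hd ha hP0 hP.
  rewrite -/N -/Z -/D => est.
  have {est} : ((N * D)%N%:Z - #|F|%:Z) ^+ 2 < ((D * Z) ^ 2 * #|F|)%N%:Z.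
    by apply: strict_int_estimate => //; [exact: card_finField_gt1 | rewrite rmorphB /= -!pmulrn].
  rewrite -(ltr_int R) rmorphXn rmorphB /= -!pmulrn => lt_sq.
  rewrite -(ltr_pM2l D0) -{1}(gtr0_norm D0) -normrM mulrBr mulrCA mulfV ?lt0r_neq0 // mulr1.
  rewrite -(ltr_pXn2r (n := 2)) // ?nnegrE ?normr_ge0 ?mulr_ge0 ?ler0n ?sqrtr_ge0 //.
  rewrite real_normK ?num_real // mulrA -!natrM exprMn sqr_sqrtr ?ler0n //.
  by rewrite -natrX -natrM [(D * N)%N]mulnC.
split; first by exists (N%:R - #|F|%:R / D%:R); rewrite addrC subrK.
move=> le_Z; case: (posnP N) => // N0; move: bound.
rewrite N0 sub0r normrN ger0_norm ?divr_ge0 ?ler0n // ltNge.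
rewrite -[in #|F|%:R / _](@sqr_sqrtr R #|F|%:R) ?ler0n // expr2 -mulrA [_ * (_ / _)]mulrC.
by rewrite ler_pM2r ?le_Z.
Qed.
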